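(* Let $k\ge1$, $a_i,b_i,c_i\in\mathbb{C}$ ($1\le i\le k$), let $T(f)$ be the tridiagonal $k$-Toeplitz operator on $\ell^2(\mathbb{N})$ with symbol $f$, and let $B_0$ denote the leading $(k-1)\times(k-1)$ principal submatrix of $A_0$. Then $$\sigma_{\det}(f)\cup\sigma_{\mathrm{wind}}(f)\subset\sigma(T(f))\subset\sigma_{\det}(f)\cup\sigma_{\mathrm{wind}}(f)\cup\sigma(B_0).$$
   Context: The tridiagonal $k$-Toeplitz operator $T(f)$ on $\ell^2(\mathbb{N})$ has matrix entries $(i,i)=a_{p(i)}$, $(i,i+1)=b_{p(i)}$, $(i+1,i)=c_{p(i)}$, $p(i)=((i-1)\bmod k)+1$, all other entries zero. Its symbol is $f(z)=A_{-1}z^{-1}+A_0+A_1z$ ($z\in\mathbb{C}\setminus\{0\}$), where $A_0$ is the $k\times k$ tridiagonal matrix with diagonal $a_1,\dots,a_k$, superdiagonal $b_1,\dots,b_{k-1}$, subdiagonal $c_1,\dots,c_{k-1}$; $A_{-1}$ has single nonzero entry $b_k$ at $(k,1)$; $A_1$ has single nonzero entry $c_k$ at $(1,k)$. $\mathbb{T}$ is the unit circle. $\sigma_{\det}(f)=\{\lambda\in\mathbb{C}: \det(f(z)-\lambda I)=0 \text{ for some } z\in\mathbb{T}\}$. Let $\lambda_1(z),\dots,\lambda_k(z)$ be the eigenvalues of $f(z)$; for $\lambda\notin\sigma_{\det}(f)$, $\sum_{j=1}^k\operatorname{wind}(\lambda_j(\mathbb{T}),\lambda)$ denotes the winding number about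 $0$ of the closed curve $z\mapsto\det(f(z)-\lambda I)=\prod_{j}(\lambda_j(z)-\lambda)$ as $z$ traverses $\mathbb{T}$ counterclockwise. Then $\sigma_{\mathrm{wind}}(f)=\{\lambda\in\mathbb{C}\setminus\sigma_{\det}(f): \sum_{j=1}^k\operatorname{wind}(\lambda_j(\mathbb{T}),\lambda)\neq0\}$. $\sigma(\cdot)$ denotes the spectrum. *)

(* Defs.v *)
From HB Require Import structures.
From mathcomp Require Import all_boot all_order all_algebra.
From mathcomp Require Import all_classical all_reals all_analysis.
From mathcomp Require Import complex.

Set Implicit Arguments.
Unset Strict Implicit.
Unset Printing Implicit Defensive.

Import Order.TTheory GRing.Theory Num.Theory.
Import numFieldNormedType.Exports.
Local Open Scope ring_scope.
Local Open Scope complex_scope.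

Section Toeplitz.
Variable R : realType.
Local Notation C := (R[i]).

Definition sqmod (z : C) : R := let: x +i* y := z in x ^+ 2 + y ^+ 2.

Definition expit (t : R) : C := (cos t) +i* (sin t).

Definition l2 (x : nat -> C) : Prop :=
  cvgn (series (fun n => sqmod (x n)) : R^nat).

Definition l2norm2 (x : nat -> C) : R :=
  limn (series (fun n => sqmod (x n)) : R^nat).

Definition bounded_op (S : (nat -> C) -> (nat -> C)) : Prop :=
  (forall x, l2 x -> l2 (S x)) /\
  (forall (u : C) x y, l2 x -> l2 y ->
      S (fun n => u * x n + y n) = (fun n => u * S x n + S y n)) /\
  (exists M : R, forall x, l2 x -> l2norm2 (S x) <= M * l2norm2 x).

Definition invertible_op (A : (nat -> C) -> (nat -> C)) : Prop :=
  exists S, bounded_op S /\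
    (forall x, l2 x -> S (A x) = x) /\
    (forall x, l2 x -> A (S x) = x).

Definition op_spectrum (A : (nat -> C) -> (nat -> C)) (lam : C) : Prop :=
  ~ invertible_op (fun x n => A x n - lam * x n).

Variables (k : nat) (hk : (0 < k)%N) (a b c : 'I_k -> C).

(* 0-based version of p(i) = ((i-1) mod k) + 1 *)
Definition pidx (i : nat) : 'I_k := Ordinal (ltn_pmod i hk).

Definition Toep (x : nat -> C) (i : nat) : C :=
  (if i is j.+1 then c (pidx j) * x j else 0)
  + a (pidx i) * x i + b (pidx i) * x i.+1.

Definition A0 : 'M[C]_k :=
  \matrix_(i, j) (if i == j then a i
                  else if (val j == (val i).+1) then b i
                  else if (val i == (val j).+1) then c j
                  else 0).
Definition Am1 : 'M[C]_k :=
  \matrix_(i, j) (if (val i == k.-1) && (val j == 0%N) then b i else 0).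
Definition Ap1 : 'M[C]_k :=
  \matrix_(i, j) (if (val i == 0%N) && (val j == k.-1) then c j else 0).

Definition symbol (z : C) : 'M[C]_k := z^-1 *: Am1 + A0 + z *: Ap1.

Definition sigma_det (lam : C) : Prop :=
  exists z : C, sqmod z = 1 /\ \det (symbol z - lam%:M) = 0.

Definition winding_number (gamma : R -> C) (w : R) : Prop :=
  exists theta : R -> R,
    {within `[0, 2 * pi], continuous theta}%classic /\
    (forall t, t \in `[0, 2 * pi] ->
       exists r : R, 0 < r /\ gamma t = r%:C * expit (theta t)) /\
    w = (theta (2 * pi) - theta 0) / (2 * pi).

Definition det_curve (lam : C) (t : R) : C := \det (symbol (expit t) - lam%:M).

Definition sigma_wind (lam : C) : Prop :=
  ~ sigma_det lam /\ exists w, winding_number (det_curve lam) w /\ w != 0.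

Definition B0 : 'M[C]_(k.-1) :=
  \matrix_(i, j) A0 (widen_ord (leq_pred k) i) (widen_ord (leq_pred k) j).

End Toeplitz.

(* Main.v *)
Require Import Defs.
From HB Require Import structures.
From mathcomp Require Import all_boot all_order all_algebra.
From mathcomp Require Import all_classical all_reals all_analysis.
From mathcomp Require Import complex zify ring lra.

(* Write [F z = z * (symbol z - lam)].  Its determinant is [z ^ (k-1) * p z] with
   [p] of degree at most 2, so the winding number of [det_curve lam] is the
   number of zeros of [p] in the open unit disc minus one.  Polynomials in [z]
   act on bilateral sequences of [k]-blocks through the shift, and the adjugate
   of [F] reduces the operator to the scalar recursion [p].

   - One zero inside, one outside: [p] splits into two geometric recursions, one
     solved forwards and one backwards, so the bilateral operator has a bounded
     inverse [G].  Compressing to the half-line needs a correction by the column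
     of [G] at the site [-1]; its diagonal entry is a nonzero multiple of
     [det (B0 - lam)], hence the operator is invertible if [lam] is not an
     eigenvalue of [B0].
   - No zero inside: [p 0 <> 0] forces every [b i <> 0], so the half-line
     recursion has a solution starting from 1, and it decays.
   - Two zeros inside: the transposed operator has such a kernel vector, and
     Lagrange's identity excludes a preimage of the first basis vector.
   - A zero on the unit circle: truncated generalized eigenvectors have bounded
     images and unbounded norms. *)

Set Implicit Arguments.
Unset Strict Implicit.
Unset Printing Implicit Defensive.

Import Order.TTheory GRing.Theory Num.Theory.
Import numFieldNormedType.Exports.
Local Open Scope ring_scope.
Local Open Scope complex_scope.

Section SquaredModulus.
Variable R : realType.
Local Notation C := (R[i]).
Implicit Types x y z s : C.

Lemma sqmod_ge0 z : 0 <= sqmod z.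
Proof. by case: z => u v; rewrite /sqmod addr_ge0 ?sqr_ge0. Qed.

Lemma sqmod0 : sqmod (0 : C) = 0.
Proof. by rewrite /sqmod /= expr0n /= addr0. Qed.

Lemma sqmod1 : sqmod (1 : C) = 1.
Proof. by rewrite /sqmod /= expr1n expr0n /= addr0. Qed.

Lemma sqmod_eq0 z : sqmod z = 0 -> z = 0.
Proof.
case: z => u v /eqP; rewrite /sqmod paddr_eq0 ?sqr_ge0 //.
by rewrite !sqrf_eq0 => /andP[/eqP-> /eqP->].
Qed.

Lemma sqmodM x y : sqmod (x * y) = sqmod x * sqmod y.
Proof. by case: x => u v; case: y => u' v' /=; ring. Qed.

Lemma sqmodX x n : sqmod (x ^+ n) = sqmod x ^+ n.
Proof. by elim: n => [|n IH]; rewrite ?sqmod1 // !exprS sqmodM IH. Qed.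

Lemma sqmodN x : sqmod (- x) = sqmod x.
Proof. by case: x => u v /=; rewrite !sqrrN. Qed.

Lemma sqmodV z : sqmod z^-1 = (sqmod z)^-1.
Proof.
have [->|z0] := eqVneq z 0; first by rewrite invr0 sqmod0 invr0.
have sz : sqmod z != 0 by apply: contra_neq z0; exact: sqmod_eq0.
by apply: (mulfI sz); rewrite -sqmodM divff // sqmod1 divff.
Qed.

Lemma sqmodD_le x y : sqmod (x + y) <= 2 * (sqmod x + sqmod y).
Proof.
case: x => u v; case: y => u' v' /=; rewrite -subr_ge0.
have -> : 2 * (u ^+ 2 + v ^+ 2 + (u' ^+ 2 + v' ^+ 2)) -
   ((u + u') ^+ 2 + (v + v') ^+ 2) = (u - u') ^+ 2 + (v - v') ^+ 2 by ring.
by rewrite addr_ge0 ?sqr_ge0.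
Qed.

(* Convexity of the square, applied to [x + y] as the barycentre of
   [x / (1 - rho)] and [y / rho]. *)
Lemma sqmodD_convex (rho : R) x y : 0 < rho < 1 ->
  sqmod (x + y) <= sqmod x / (1 - rho) + sqmod y / rho.
Proof.
move=> /andP[r0 r1]; case: x => u v; case: y => u' v' /=.
rewrite -subr_ge0.
have r1' : 0 < 1 - rho by rewrite subr_gt0.
have -> : (u ^+ 2 + v ^+ 2) / (1 - rho) + (u' ^+ 2 + v' ^+ 2) / rho -
   ((u + u') ^+ 2 + (v + v') ^+ 2) =
   ((rho * u - (1 - rho) * u') ^+ 2 + (rho * v - (1 - rho) * v') ^+ 2) /
     (rho * (1 - rho)) by field; rewrite !gt_eqF.
by rewrite divr_ge0 ?addr_ge0 ?sqr_ge0 ?mulr_ge0 // ltW.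
Qed.

Lemma sqmod_ratio s : sqmod s < 1 ->
  exists2 rho : R, 0 < rho < 1 & sqmod s <= rho ^+ 2.
Proof.
have := sqmod_ge0 s; move: (sqmod s) => q q0 q1.
by exists ((1 + q) / 2); nra.
Qed.

Lemma sqmod_geo_step (rho : R) s x y : 0 < rho < 1 -> sqmod s <= rho ^+ 2 ->
  sqmod (x + s * y) <= sqmod x / (1 - rho) + rho * sqmod y.
Proof.
move=> r01 sr; apply: le_trans (sqmodD_convex _ _ r01) _.
case/andP: r01 => r0 r1; rewrite lerD2l sqmodM ler_pdivrMr //.
by rewrite mulrAC -expr2 ler_wpM2r ?sqmod_ge0.
Qed.

Lemma sqmod_sum_le (I : finType) (f : I -> C) :
  sqmod (\sum_i f i) <= 2 ^+ #|I| * \sum_i sqmod (f i).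
Proof.
rewrite cardE -!big_enum /=; elim: (enum I) => [|i s IH].
  by rewrite !big_nil sqmod0 mulr0.
rewrite !big_cons /= exprS -mulrA; apply: le_trans (sqmodD_le _ _) _.
rewrite ler_pM2l // mulrDr lerD // ler_peMl ?sqmod_ge0 //.
by rewrite exprn_ege1 // ler1n.
Qed.

End SquaredModulus.

(** * Square-summable bilateral sequences *)

Section Bilateral.
Variable R : realType.
Local Notation C := (R[i]).
Implicit Types (x y g : int -> C) (K : R).

(* Bounding all windows uniformly makes translation invariance immediate. *)
Definition l2Z_le x K : Prop :=
  forall (m : int) (N : nat), \sum_(i < N) sqmod (x (m + i%:Z)) <= K.

Lemma l2Z_le_ge0 x K : l2Z_le x K -> 0 <= K.
Proof. by move=> /(_ 0 0%N); rewrite big_ord0. Qed.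

Lemma l2Z_le_pt x K n : l2Z_le x K -> sqmod (x n) <= K.
Proof. by move=> /(_ n 1%N); rewrite big_ord1 addr0. Qed.

Lemma l2Z_le_weak x K K' : K <= K' -> l2Z_le x K -> l2Z_le x K'.
Proof. by move=> KK xK m N; apply: le_trans (xK _ _) KK. Qed.

Lemma l2Z_le_shift x K (d : int) : l2Z_le x K -> l2Z_le (fun n => x (n + d)) K.
Proof.
move=> xK m N; have := xK (m + d) N; congr (_ <= _); apply: eq_bigr => i _.
by rewrite addrAC.
Qed.

Lemma l2Z_le_rev x K : l2Z_le x K -> l2Z_le (fun n => x (- n)) K.
Proof.
move=> xK m N; have := xK (- m - N%:Z + 1) N; congr (_ <= _).
rewrite (reindex_inj rev_ord_inj) /=; apply: eq_bigr => i _.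
by congr (sqmod (x _)); have := ltn_ord i; lia.
Qed.

Lemma l2Z_le0 : l2Z_le (fun=> 0) 0.
Proof. by move=> m N; rewrite big1 // => i _; rewrite sqmod0. Qed.

Lemma l2Z_leZ (u : C) x K : l2Z_le x K -> l2Z_le (fun n => u * x n) (sqmod u * K).
Proof.
move=> xK m N; under eq_bigr do rewrite sqmodM.
by rewrite -mulr_sumr ler_wpM2l ?sqmod_ge0.
Qed.

Lemma l2Z_leD x y K K' : l2Z_le x K -> l2Z_le y K' ->
  l2Z_le (fun n => x n + y n) (2 * (K + K')).
Proof.
move=> xK yK m N.
apply: (@le_trans _ _ (\sum_(i < N) 2 * (sqmod (x (m + i%:Z)) + sqmod (y (m + i%:Z))))).
  by apply: ler_sum => i _; exact: sqmodD_le.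
by rewrite -mulr_sumr ler_pM2l // big_split lerD.
Qed.

Lemma l2Z_le_sum (I : finType) (X : I -> int -> C) K : (forall i, l2Z_le (X i) K) ->
  l2Z_le (fun n => \sum_i X i n) (2 ^+ #|I| * (#|I|%:R * K)).
Proof.
move=> XK m N.
apply: (@le_trans _ _ (\sum_(j < N) 2 ^+ #|I| * \sum_i sqmod (X i (m + j%:Z)))).
  by apply: ler_sum => j _; exact: sqmod_sum_le.
rewrite -mulr_sumr ler_wpM2l ?exprn_ge0 // exchange_big /= mulr_natl -sumr_const.
by apply: ler_sum => i _; exact: XK.
Qed.

Definition delta (m n : int) : C := (n == m)%:R.

Lemma l2Z_le_delta m : l2Z_le (delta m) 1.
Proof.
move=> l N; have [lm|lm] := leP l m; last first.
  rewrite big1 ?ler01 // => i _; rewrite /delta; case: eqP; last by rewrite sqmod0.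
  by move=> e; exfalso; lia.
have [/= iN|iN] := ltnP `|m - l|%N N.
  rewrite (bigD1 (Ordinal iN)) //= big1 => [|i ii].
    by rewrite /delta addr0; case: eqP; rewrite ?sqmod1 ?sqmod0 ?ler01.
  rewrite /delta; case: eqP; last by rewrite sqmod0.
  move=> e; case/eqP: ii; apply: val_inj => /=; lia.
rewrite big1 ?ler01 // => i _; rewrite /delta; case: eqP; last by rewrite sqmod0.
by move=> e; exfalso; have := ltn_ord i; lia.
Qed.

End Bilateral.

Section ComplexLimits.
Variable R : realType.
Local Notation C := (R[i]).
Local Notation Re := (@complex.Re R).
Local Notation Im := (@complex.Im R).
Implicit Types (u : nat -> C) (l : C).

Definition ccvg u l : Prop :=
  ((fun n => Re (u n)) @ \oo --> Re l)%classic /\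
  ((fun n => Im (u n)) @ \oo --> Im l)%classic.

Lemma ccvg_unique u l l' : ccvg u l -> ccvg u l' -> l = l'.
Proof.
move=> [ul1 ul2] [ul1' ul2']; apply/eqP; rewrite eq_complex; apply/andP; split; apply/eqP.
  by rewrite -(cvg_lim (@Rhausdorff R) ul1) (cvg_lim (@Rhausdorff R) ul1').
by rewrite -(cvg_lim (@Rhausdorff R) ul2) (cvg_lim (@Rhausdorff R) ul2').
Qed.

Lemma ccvg_shift u l : ccvg u l -> ccvg (fun n => u n.+1) l.
Proof.
move=> [u1 u2]; split.
  by have := u1; rewrite -cvg_shiftS.
by have := u2; rewrite -cvg_shiftS.
Qed.

Lemma ccvg_affine (w v : C) u l : ccvg u l -> ccvg (fun n => w + v * u n) (w + v * l).
Proof.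
case: w v l => [w1 w2] [v1 v2] [l1 l2] [/= u1 u2].
have ReE n : Re ((w1 +i* w2) + (v1 +i* v2) * u n) = w1 + (v1 * Re (u n) - v2 * Im (u n)).
  by case: (u n).
have ImE n : Im ((w1 +i* w2) + (v1 +i* v2) * u n) = w2 + (v1 * Im (u n) + v2 * Re (u n)).
  by case: (u n).
split=> /=.
  under eq_fun do rewrite ReE.
  by apply: cvgD; [exact: cvg_cst|apply: cvgB; apply: cvgM => //; exact: cvg_cst].
under eq_fun do rewrite ImE.
by apply: cvgD; [exact: cvg_cst|apply: cvgD; apply: cvgM => //; exact: cvg_cst].
Qed.

Lemma ccvg_sqmod u l : ccvg u l -> ((fun n => sqmod (u n)) @ \oo --> sqmod l)%classic.
Proof.
case: l => l1 l2 [/= u1 u2].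
have E n : sqmod (u n) = Re (u n) * Re (u n) + Im (u n) * Im (u n).
  by case: (u n).
under eq_fun do rewrite E.
by rewrite !expr2; apply: cvgD; apply: cvgM.
Qed.

Lemma ReD (z w : C) : Re (z + w) = Re z + Re w.
Proof. by case: z; case: w. Qed.

Lemma ImD (z w : C) : Im (z + w) = Im z + Im w.
Proof. by case: z; case: w. Qed.

Lemma dominated_series_cvg (f : nat -> R) (rho B : R) : 0 < rho < 1 ->
  (forall n, `|f n| <= B * rho ^+ n) -> cvgn (series f).
Proof.
move=> /andP[r0 r1] fB; apply: normed_cvg.
apply: (@series_le_cvg _ _ (geometric B rho)) => [n|n|n|].
- exact: normr_ge0.
- exact: le_trans (normr_ge0 _) (fB n).
- exact: fB.
- by apply: is_cvg_geometric_series; rewrite ger0_norm // ltW.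
Qed.

Lemma ccvg_dominated_series u (rho K : R) : 0 < rho < 1 ->
  (forall n, sqmod (u n) <= K * (rho ^+ n) ^+ 2) ->
  exists l, ccvg (fun n => \sum_(i < n) u i) l.
Proof.
move=> r01 uK.
have K0 : 0 <= K.
  by have := le_trans (sqmod_ge0 _) (uK 0%N); rewrite expr0 expr1n mulr1.
have aux (f : C -> R) : (forall z, f z ^+ 2 <= sqmod z) ->
    forall n, `|f (u n)| <= (1 + K) * rho ^+ n.
  move=> fs n; have rn : 0 <= rho ^+ n by case/andP: r01 => /ltW r0 _; rewrite exprn_ge0.
  rewrite -ler_sqr ?nnegrE ?mulr_ge0 // ?addr_ge0 // real_normK ?num_real //.
  apply: le_trans (fs _) (le_trans (uK n) _); rewrite exprMn ler_wpM2r ?sqr_ge0 //.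
  nra.
have cR := dominated_series_cvg r01 (aux Re _).
have cI := dominated_series_cvg r01 (aux Im _).
exists (limn (series (fun n => Re (u n))) +i* limn (series (fun n => Im (u n)))).
have RS n : Re (\sum_(i < n) u i) = series (fun n => Re (u n)) n.
  by rewrite /series /= big_mkord (big_morph Re ReD (erefl : Re 0 = 0)).
have IS n : Im (\sum_(i < n) u i) = series (fun n => Im (u n)) n.
  by rewrite /series /= big_mkord (big_morph Im ImD (erefl : Im 0 = 0)).
split=> /=.
  by under eq_fun do rewrite RS; apply: cR; case=> x y /=; rewrite lerDl sqr_ge0.
by under eq_fun do rewrite IS; apply: cI; case=> x y /=; rewrite lerDr sqr_ge0.
Qed.

End ComplexLimits.

Section Geometric.
Variable R : realType.
Local Notation C := (R[i]).
Implicit Types (x y g : int -> C) (K : R).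

Lemma geometric_solve (s : C) : sqmod s < 1 ->
  exists2 M : R, 0 <= M & forall y K, l2Z_le y K ->
    exists2 g, l2Z_le g (M * K) & forall n, g n - s * g (n - 1) = y n.
Proof.
move=> /sqmod_ratio[rho r01 sr].
have [r0 r1] := andP r01; have r1' : 0 < 1 - rho by rewrite subr_gt0.
exists ((1 - rho) ^- 2); first by rewrite invr_ge0 sqr_ge0.
move=> y K yK; pose P m n := \sum_(j < m) s ^+ j * y (n - j%:Z).
have PS m n : P m.+1 n = y n + s * P m (n - 1).
  rewrite /P big_ord_recl expr0 mul1r subr0 mulr_sumr; congr (_ + _).
  apply: eq_bigr => j _; rewrite exprS mulrA; congr (_ * y _) => /=.
  by rewrite /bump /=; lia.
have P2 m : l2Z_le (P m) ((1 - rho) ^- 2 * K).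
  elim: m => [|m IH] l N.
    rewrite big1 => [|i _]; last by rewrite /P big_ord0 sqmod0.
    by rewrite mulr_ge0 ?invr_ge0 ?sqr_ge0 // (l2Z_le_ge0 yK).
  apply: (@le_trans _ _ (\sum_(i < N) (sqmod (y (l + i%:Z)) / (1 - rho) +
      rho * sqmod (P m (l + i%:Z - 1))))).
    by apply: ler_sum => i _; rewrite PS; exact: sqmod_geo_step.
  rewrite big_split /= -mulr_suml -mulr_sumr.
  have -> : (1 - rho) ^- 2 * K = K / (1 - rho) + rho * ((1 - rho) ^- 2 * K).
    by field; rewrite gt_eqF.
  apply: lerD; first by rewrite ler_pM2r ?invr_gt0 //; exact: yK.
  by rewrite ler_pM2l //; exact: (l2Z_le_shift (-1) IH).
have cvP n : exists l, ccvg (P^~ n) l.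
  apply: (@ccvg_dominated_series _ (fun j => s ^+ j * y (n - j%:Z)) rho K) => // j.
  rewrite sqmodM mulrC sqmodX -exprM mulnC exprM.
  apply: ler_pM; rewrite ?exprn_ge0 ?sqmod_ge0 //; first exact: l2Z_le_pt.
  by apply: lerXn2r; rewrite ?nnegrE ?sqmod_ge0 ?sqr_ge0.
have [g gP] := choice cvP.
exists g.
  move=> m N.
  have cv : ((fun j => \sum_(i < N) sqmod (P j (m + i%:Z))) @ \oo -->
     \sum_(i < N) sqmod (g (m + i%:Z)))%classic.
    apply: cvg_big => [|i _]; first exact: add_continuous.
    exact: ccvg_sqmod (gP _).
  rewrite -(cvg_lim (@Rhausdorff R) cv); apply: limr_le; first exact: cvgP cv.
  by near=> j; exact: P2.
move=> n; apply/eqP; rewrite subr_eq; apply/eqP.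
apply: (ccvg_unique (ccvg_shift (gP n))).
have := ccvg_affine (y n) s (gP (n - 1)).
by congr ccvg; apply/funext => j; rewrite PS.
Unshelve. all: by end_near. Qed.

Lemma geometric_solve_rev (r : C) : sqmod r < 1 ->
  exists2 M : R, 0 <= M & forall y K, l2Z_le y K ->
    exists2 g, l2Z_le g (M * K) & forall n, g (n - 1) - r * g n = y n.
Proof.
move=> /geometric_solve[M M0 HM]; exists M => // y K yK.
have [g gK gE] := HM _ _ (l2Z_le_rev yK).
exists (fun n => g (- n - 1)).
  apply: (@l2Z_le_rev _ (fun n => g (n - 1))); exact: l2Z_le_shift.
move=> n; have := gE (- n); rewrite opprK => <-.
by congr (g _ - _); lia.
Qed.

Lemma geometric_unique (s : C) x K (n0 : int) : sqmod s < 1 ->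
  (forall n, n <= n0 -> x n = s * x (n - 1)) ->
  (forall n, n < 0 -> sqmod (x n) <= K) -> x n0 = 0.
Proof.
move=> s1 xE xK; apply: sqmod_eq0; apply/eqP; rewrite eq_le sqmod_ge0 andbT.
have xm m : x n0 = s ^+ m * x (n0 - m%:Z).
  elim: m => [|m IH]; first by rewrite expr0 mul1r subr0.
  rewrite IH xE; last by lia.
  by rewrite mulrA -exprSr; congr (_ * x _); lia.
have cv : ((fun m => sqmod s ^+ m * K) @ \oo --> 0)%classic.
  rewrite -[X in (_ --> X)%classic](mul0r K); apply: cvgM; last exact: cvg_cst.
  by apply: cvg_expr; rewrite ger0_norm ?sqmod_ge0.
rewrite -(cvg_lim (@Rhausdorff R) cv); apply: limr_ge; first exact: cvgP cv.
near=> m; rewrite (xm m) sqmodM sqmodX ler_wpM2l ?exprn_ge0 ?sqmod_ge0 // xK //.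
have : (`|n0|.+1 <= m)%N by near: m; exact: nbhs_infty_ge.
lia.
Unshelve. all: by end_near. Qed.

Lemma geometric_unique_rev (r : C) x K : sqmod r < 1 ->
  (forall n, x (n - 1) = r * x n) -> (forall n, sqmod (x n) <= K) ->
  forall n, x n = 0.
Proof.
move=> r1 xE xK n; rewrite -(opprK n).
apply: (@geometric_unique r (fun n => x (- n)) K) => // m _.
by rewrite opprB addrC -xE; congr x; lia.
Qed.

End Geometric.

(** * Polynomials in the bilateral shift *)

Section PolynomialAction.
Variable R : realType.
Local Notation C := (R[i]).
Implicit Types (x y : int -> C) (p q : {poly C}) (n d : int).

Definition act q x n : C := \sum_(j < size q) q`_j * x (n - j%:Z).

Lemma act_widen N q x n : (size q <= N)%N ->
  act q x n = \sum_(j < N) q`_j * x (n - j%:Z).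
Proof.
move=> qN; rewrite /act (big_ord_widen N (fun j : nat => q`_j * x (n - j%:Z)) qN).
rewrite big_mkcond /=; apply: eq_bigr => j _.
by case: ltnP => // jq; rewrite nth_default // mul0r.
Qed.

Lemma act_shift q x d n : act q (fun n => x (n + d)) n = act q x (n + d).
Proof. by apply: eq_bigr => j _; rewrite addrAC. Qed.

Lemma eq_act q x y : x =1 y -> act q x =1 act q y.
Proof. by move=> xy n; apply: eq_bigr => j _; rewrite xy. Qed.

Lemma act0r q n : act q (fun=> 0) n = 0.
Proof. by rewrite /act big1 // => j _; rewrite mulr0. Qed.

Lemma actDr q x y n : act q (fun n => x n + y n) n = act q x n + act q y n.
Proof. by rewrite -big_split; apply: eq_bigr => j _; rewrite mulrDr. Qed.

Lemma actZr q (u : C) x n : act q (fun n => u * x n) n = u * act q x n.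
Proof. by rewrite mulr_sumr; apply: eq_bigr => j _; rewrite mulrCA. Qed.

Lemma act_sumr (I : finType) q (X : I -> int -> C) n :
  act q (fun n => \sum_i X i n) n = \sum_i act q (X i) n.
Proof. by rewrite exchange_big /=; apply: eq_bigr => j _; rewrite mulr_sumr. Qed.

Lemma act0 x n : act 0 x n = 0.
Proof. by rewrite /act size_poly0 big_ord0. Qed.

Lemma actD p q x n : act (p + q) x n = act p x n + act q x n.
Proof.
set N := maxn (size p) (size q).
rewrite !(@act_widen N) ?leq_maxl ?leq_maxr //; last exact: size_polyD.
by rewrite -big_split; apply: eq_bigr => j _; rewrite coefD mulrDl.
Qed.

Lemma act_polyC (u : C) x n : act u%:P x n = u * x n.
Proof.
by rewrite (@act_widen 1) ?size_polyC_leq1 // big_ord1 coefC subr0.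
Qed.

Lemma act1 x n : act 1 x n = x n.
Proof. by rewrite -[1]/(1%:P) act_polyC mul1r. Qed.

Lemma actCM (u : C) q x n : act (u%:P * q) x n = u * act q x n.
Proof.
rewrite (@act_widen (size q)) ?mulr_sumr; last first.
  by rewrite mul_polyC size_scale_leq.
by apply: eq_bigr => j _; rewrite coefCM mulrA.
Qed.

Lemma actN q x n : act (- q) x n = - act q x n.
Proof. by rewrite -mulN1r -polyCN actCM mulN1r. Qed.

Lemma actMX q x n : act (q * 'X) x n = act q x (n - 1).
Proof.
rewrite (@act_widen (size q).+1); last first.
  have [->|q0] := eqVneq q 0; first by rewrite mul0r size_poly0.
  by rewrite size_mulX.
rewrite big_ord_recl coefMX eqxx mul0r add0r; apply: eq_bigr => j _.
by rewrite coefMX /=; congr (_ * x _); rewrite /bump /=; lia.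
Qed.

Lemma actX x n : act 'X x n = x (n - 1).
Proof. by rewrite -['X]mul1r actMX act1. Qed.

Lemma actM p q x n : act (p * q) x n = act p (act q x) n.
Proof.
elim/poly_ind: p n => [|p u IH] n; first by rewrite mul0r !act0.
rewrite mulrDl !actD mulrAC !actMX IH actCM act_polyC; congr (_ + _).
Qed.

Lemma actMXn q m x n : act (q * 'X^m) x n = act q x (n - m%:Z).
Proof.
elim: m n => [|m IH] n; first by rewrite expr0 mulr1 subr0.
by rewrite exprSr mulrA actMX IH; congr (act q x _); lia.
Qed.

Lemma act_sum (I : finType) (q : I -> {poly C}) x n :
  act (\sum_i q i) x n = \sum_i act (q i) x n.
Proof.
by apply: (big_morph (fun q => act q x n)) => [p q'|]; rewrite ?actD ?act0.
Qed.

Lemma act_l2Z q : exists2 M : R, 0 <= M &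
  forall x K, l2Z_le x K -> l2Z_le (act q x) (M * K).
Proof.
elim/poly_ind: q => [|q u [M M0 IH]].
  exists 0 => // x K xK; rewrite mul0r.
  have -> : act 0 x = fun=> 0 by apply/funext => n; rewrite act0.
  exact: l2Z_le0.
exists (2 * (M + sqmod u)); first by rewrite mulr_ge0 ?addr_ge0 ?sqmod_ge0.
move=> x K xK; rewrite -mulrA [(M + _) * K]mulrDl.
have -> : act (q * 'X + u%:P) x = fun n => act q x (n - 1) + u * x n.
  by apply/funext => n; rewrite actD actMX act_polyC.
exact: l2Z_leD (l2Z_le_shift (-1) (IH _ _ xK)) (l2Z_leZ u xK).
Qed.

Lemma act_XsubC r x n : act ('X - r%:P) x n = x (n - 1) - r * x n.
Proof. by rewrite actD actN actX act_polyC. Qed.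

Lemma act_1subCX s x n : act (1 - s%:P * 'X) x n = x n - s * x (n - 1).
Proof. by rewrite actD actN actCM actX act1. Qed.

Lemma act_delta_small q m n : n < m -> act q (delta R m) n = 0.
Proof.
move=> mn; rewrite /act big1 // => j _; rewrite /delta.
case: eqP => e; last by rewrite mulr0.
by exfalso; have := ltn_ord j; lia.
Qed.

End PolynomialAction.

Section FactoredSymbols.
Variable R : realType.
Local Notation C := (R[i]).
Variables kappa r s : C.
Hypotheses (kappa0 : kappa != 0) (r1 : sqmod r < 1) (s1 : sqmod s < 1).

(* Zeros: [r] inside and [1/s] outside the unit circle; then both outside; then
   both inside. *)
Definition mixed_quadratic : {poly C} := kappa%:P * ('X - r%:P) * (1 - s%:P * 'X).

Definition outer_quadratic : {poly C} :=
  kappa%:P * (1 - r%:P * 'X) * (1 - s%:P * 'X).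

Definition inner_quadratic : {poly C} := kappa%:P * ('X - r%:P) * ('X - s%:P).

Lemma mixed_solve : exists2 M : R, 0 <= M & forall y K, l2Z_le y K ->
  exists2 x, l2Z_le x (M * K) & forall n, act mixed_quadratic x n = y n.
Proof.
have [M1 M10 H1] := geometric_solve s1.
have [M2 M20 H2] := geometric_solve_rev r1.
exists (M2 * (M1 * sqmod kappa^-1)); first by rewrite !mulr_ge0 ?sqmod_ge0.
move=> y K yK.
have [v vK vE] := H1 _ _ (l2Z_leZ kappa^-1 yK).
have [x xK xE] := H2 _ _ vK.
exists x; first by rewrite -!mulrA.
move=> n; rewrite /mixed_quadratic -mulrA [('X - _) * _]mulrC actCM actM act_1subCX.
by rewrite !act_XsubC !xE vE mulVKf.
Qed.

Lemma mixed_unique x K : (forall n, sqmod (x n) <= K) ->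
  (forall n, act mixed_quadratic x n = 0) -> forall n, x n = 0.
Proof.
move=> xK x0.
have g0 : forall n, act (1 - s%:P * 'X) x n = 0.
  apply: (@geometric_unique_rev _ r _ (2 * (K + sqmod s * K))) => // n.
    have /eqP := x0 n; rewrite /mixed_quadratic -mulrA actCM mulf_eq0 (negPf kappa0) /=.
    by rewrite actM act_XsubC subr_eq0 => /eqP.
  rewrite act_1subCX; apply: le_trans (sqmodD_le _ _) _.
  by rewrite ler_pM2l // lerD // sqmodN sqmodM ler_wpM2l ?sqmod_ge0.
move=> n; apply: (geometric_unique (n0 := n) (K := K) s1) => // m _.
by have /eqP := g0 m; rewrite act_1subCX subr_eq0 => /eqP.
Qed.

(* The value is in fact [1 / (kappa * (1 - r * s))], the constant Laurent
   coefficient of [z / mixed_quadratic.[z]] on the unit circle. *)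
Lemma mixed_fundamental_neq0 x K m : (forall n, sqmod (x n) <= K) ->
  (forall n, act mixed_quadratic x n = delta R m n) -> x (m - 1) <> 0.
Proof.
move=> xK xE x0.
pose v := act ('X - r%:P) x; pose g := act (1 - s%:P * 'X) x.
have vE n : v n - s * v (n - 1) = kappa^-1 * delta R m n.
  apply: (mulfI kappa0); rewrite mulVKf // -xE /mixed_quadratic -mulrA.
  by rewrite [('X - _) * _]mulrC actCM actM act_1subCX.
have gE n : g (n - 1) - r * g n = kappa^-1 * delta R m n.
  apply: (mulfI kappa0); rewrite mulVKf // -xE /mixed_quadratic -mulrA.
  by rewrite actCM actM act_XsubC.
have gK n : sqmod (g n) <= 2 * (K + sqmod s * K).
  rewrite /g act_1subCX; apply: le_trans (sqmodD_le _ _) _.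
  by rewrite ler_pM2l // lerD // sqmodN sqmodM ler_wpM2l ?sqmod_ge0.
have vK n : sqmod (v n) <= 2 * (K + sqmod r * K).
  rewrite /v act_XsubC; apply: le_trans (sqmodD_le _ _) _.
  by rewrite ler_pM2l // lerD // sqmodN sqmodM ler_wpM2l ?sqmod_ge0.
have K0 : 0 <= K by apply: le_trans (xK 0); exact: sqmod_ge0.
have gm : g m = 0.
  rewrite -(opprK m); apply: (@geometric_unique _ r (fun n => g (- n)) _ (- m) r1) => n.
    move=> nm; have := gE (- n + 1); rewrite addrK /delta.
    have -> : (- n + 1 == m) = false by apply/eqP; lia.
    rewrite mulr0 => /eqP; rewrite subr_eq0 => /eqP ->.
    by congr (_ * g _); lia.
  by move=> _; exact: gK.
have vm : v (m - 1) = 0.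
  apply: (@geometric_unique _ s v _ (m - 1) s1) => n; last by move=> _; exact: vK.
  move=> nm; have := vE n; rewrite /delta.
  have -> : (n == m) = false by apply/eqP; lia.
  by rewrite mulr0 => /eqP; rewrite subr_eq0 => /eqP.
have xm : x m = 0.
  by move: gm; rewrite /g act_1subCX x0 mulr0 subr0.
have := vE m; rewrite vm mulr0 subr0 {1}/v act_XsubC x0 xm mulr0 subr0 /delta eqxx mulr1.
by move/esym/eqP; rewrite invr_eq0 (negPf kappa0).
Qed.

Lemma outer_l2Z x z K : l2Z_le z K -> (forall n, n < 0 -> x n = 0) ->
  (forall n, act outer_quadratic x n = z n) -> exists K', l2Z_le x K'.
Proof.
move=> zK xneg xE.
have solve t (g y : int -> C) L : sqmod t < 1 -> l2Z_le y L ->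
    (forall n, n < 0 -> g n = 0) -> (forall n, g n - t * g (n - 1) = y n) ->
    exists L', l2Z_le g L'.
  move=> t1 yL gneg gE; have [M _ /(_ _ _ yL)[h hL hE]] := geometric_solve t1.
  exists (M * L); suff -> : g = h by [].
  apply/funext => n; apply/eqP; rewrite -subr_eq0; apply/eqP.
  apply: (@geometric_unique _ t (fun n => g n - h n) (M * L) n t1) => m m0.
    have : g m - t * g (m - 1) = h m - t * h (m - 1) by rewrite gE hE.
    by move/eqP; rewrite subr_eq => /eqP ->; ring.
  by rewrite gneg // sub0r sqmodN; exact: l2Z_le_pt.
have [L gL] : exists L, l2Z_le (act (1 - s%:P * 'X) x) L.
  apply: (solve r _ _ _ r1 (l2Z_leZ kappa^-1 zK)) => [n n0|n].
    by rewrite act_1subCX !xneg ?mulr0 ?subr0 //; lia.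
  apply: (mulfI kappa0); rewrite mulVKf // -xE /outer_quadratic -mulrA.
  by rewrite actCM actM (act_1subCX r).
by apply: (solve s _ _ _ s1 gL) => // n; rewrite act_1subCX.
Qed.

End FactoredSymbols.

(** * Determinant of the symbol *)

Section DeterminantPerturbation.

Lemma det_add_delta (S : comPzRingType) n (A : 'M[S]_n) i j u :
  \det (A + u *: delta_mx i j) = \det A + u * cofactor A i j.
Proof.
have cofE l : cofactor (A + u *: delta_mx i j) i l = cofactor A i l.
  rewrite /cofactor; congr (_ * \det _); apply/matrixP => i' j'.
  by rewrite !mxE eq_sym (negPf (neq_lift _ _)) mulr0 addr0.
rewrite !(expand_det_row _ i).
under eq_bigr do rewrite cofE !mxE eqxx /= mulrDl.
rewrite big_split /=; congr (_ + _).
rewrite (bigD1 j) //= eqxx mulr1 big1 ?addr0 // => l /negPf ->.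
by rewrite mulr0 mul0r.
Qed.

Lemma det_corner_perturbation (S : comNzRingType) m (A : 'M[S]_m.+1) (u v : S) :
  exists beta : S,
  \det ('X *: map_mx polyC A + v%:P *: delta_mx ord_max ord0 +
        ('X^2 * u%:P) *: delta_mx ord0 ord_max) =
  ((v * cofactor A ord_max ord0)%:P + beta%:P * 'X +
   (u * cofactor A ord0 ord_max)%:P * 'X^2) * 'X^m.
Proof.
case: m A => [|m] A.
  exists (A ord0 ord0).
  have cof1 i j : cofactor A i j = 1.
    by rewrite /cofactor !ord1 det_mx00 expr0 mulr1.
  have -> : ord_max = ord0 :> 'I_1 by apply: val_inj.
  by rewrite det_mx11 !mxE eqxx !cof1 !mulr1; ring.
pose N := row' ord0 (col' ord_max A).
have cofX n (B : 'M[S]_n.+1) i j :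
    cofactor ('X *: map_mx polyC B) i j = 'X^n * (cofactor B i j)%:P.
  rewrite /cofactor rmorphM rmorphXn rmorphN1 /= mulrCA; congr (_ * _).
  rewrite -det_map_mx /= -detZ; congr (\det _).
  by apply/matrixP => i' j'; rewrite !mxE.
exists (\det A + u * v * (-1) ^+ m.+1 * cofactor N ord_max ord0).
have detX n (B : 'M[S]_n) : \det ('X *: map_mx polyC B) = 'X^n * (\det B)%:P.
  by rewrite detZ -det_map_mx.
have cof_corner : cofactor ('X *: map_mx polyC A + v%:P *: delta_mx ord_max ord0)
      ord0 ord_max =
    (-1) ^+ m.+1 * ('X^(m.+1) * (\det N)%:P + v%:P * ('X^m * (cofactor N ord_max ord0)%:P)).
  rewrite -detX -cofX -det_add_delta /cofactor add0n; congr (_ * \det _).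
  apply/matrixP => i j; rewrite !mxE; congr (_ + _ * (_ && _)%:R).
  by rewrite -!val_eqE /= /bump /=; lia.
have cofN : cofactor A ord0 ord_max = (-1) ^+ m.+1 * \det N by rewrite /cofactor add0n.
rewrite !det_add_delta cofX detX cof_corner cofN.
rewrite !rmorphD !rmorphM !rmorphXn !rmorphN1 /= !addn0 !exprS.
move: ('X^m) ((-1) ^+ m : {poly S}) => Xm em; ring.
Qed.

End DeterminantPerturbation.

(** * Block sequences *)

Section BlockAction.
Variables (R : realType) (k : nat).
Local Notation C := (R[i]).
Implicit Types (X : 'I_k -> int -> C) (F G : 'M[{poly C}]_k).

Definition blockact F X i n : C := \sum_j act (F i j) (X j) n.

Lemma blockactM F G X i n :
  blockact (F *m G) X i n = blockact F (blockact G X) i n.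
Proof.
rewrite /blockact.
under eq_bigr => j _ do rewrite mxE act_sum.
rewrite exchange_big /=; apply: eq_bigr => l _; rewrite act_sumr.
by apply: eq_bigr => j _; rewrite actM.
Qed.

Lemma blockact_scalar q X i n : blockact q%:M X i n = act q (X i) n.
Proof.
rewrite /blockact (bigD1 i) //= mxE eqxx mulr1n big1 ?addr0 // => j ji.
by rewrite mxE eq_sym (negPf ji) mulr0n act0.
Qed.

Lemma blockact_shift F X d i n :
  blockact F (fun j n => X j (n + d)) i n = blockact F X i (n + d).
Proof. by apply: eq_bigr => j _; rewrite act_shift. Qed.

Lemma blockact_comb F X Y (u : C) i n :
  blockact F (fun j n => X j n + u * Y j n) i n =
  blockact F X i n + u * blockact F Y i n.
Proof.
rewrite /blockact mulr_sumr -big_split; apply: eq_bigr => j _.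
by rewrite (actDr _ (X j) (fun n => u * Y j n)) actZr.
Qed.

Lemma eq_blockact F X Y i n : (forall j n, X j n = Y j n) ->
  blockact F X i n = blockact F Y i n.
Proof. by move=> XY; apply: eq_bigr => j _; apply: eq_act. Qed.

Lemma blockact_l2Z F : exists2 M : R, 0 <= M & forall X K,
  (forall j, l2Z_le (X j) K) -> forall i, l2Z_le (blockact F X i) (M * K).
Proof.
have /choice[M MP] : forall ij : 'I_k * 'I_k, exists M : R, 0 <= M /\
    forall x K, l2Z_le x K -> l2Z_le (act (F ij.1 ij.2) x) (M * K).
  by move=> ij; have [M M0 MP] := act_l2Z (F ij.1 ij.2); exists M.
have M0 ij : 0 <= M ij by case: (MP ij).
exists (2 ^+ k * (k%:R * \sum_ij M ij)).
  by rewrite !mulr_ge0 ?exprn_ge0 // sumr_ge0.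
move=> X K XK i; rewrite -2!mulrA.
have := @l2Z_le_sum _ 'I_k (fun j => act (F i j) (X j)) ((\sum_ij M ij) * K).
rewrite card_ord; apply=> j.
apply: l2Z_le_weak ((MP (i, j)).2 _ _ (XK j)).
rewrite ler_wpM2r ?(l2Z_le_ge0 (XK j)) // (bigD1 (i, j)) //= lerDl.
by rewrite sumr_ge0.
Qed.

End BlockAction.

Section SquareSummable.
Variable R : realType.
Local Notation C := (R[i]).
Implicit Types (x : nat -> C) (K : R).

Lemma l2_le_bounded x K : (forall N, \sum_(n < N) sqmod (x n) <= K) ->
  l2 x /\ l2norm2 x <= K.
Proof.
move=> xK; have serE N : series (fun n => sqmod (x n)) N = \sum_(n < N) sqmod (x n).
  by rewrite /series /= big_mkord.
have cv : l2 x.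
  apply: nondecreasing_is_cvgn.
    by apply: nondecreasing_series => n _ _; exact: sqmod_ge0.
  by exists K => _ [N _ <-]; rewrite serE.
by split=> //; apply: limr_le => //; near=> N; rewrite serE.
Unshelve. all: by end_near. Qed.

Lemma l2_partial_le x N : l2 x -> \sum_(n < N) sqmod (x n) <= l2norm2 x.
Proof.
move=> xl2; have := nondecreasing_cvgn_le _ xl2 N; rewrite /series /= big_mkord; apply.
by apply: nondecreasing_series => n _ _; exact: sqmod_ge0.
Qed.

Lemma l2_pt_le x n : l2 x -> sqmod (x n) <= l2norm2 x.
Proof.
move=> /(l2_partial_le n.+1); apply: le_trans; rewrite big_ord_recr /= lerDr.
by rewrite sumr_ge0 // => i _; exact: sqmod_ge0.
Qed.

Lemma l2norm2_ge0 x : l2 x -> 0 <= l2norm2 x.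
Proof. by move=> /(l2_partial_le 0); rewrite big_ord0. Qed.

Lemma l2_comb (u : C) x y : l2 x -> l2 y -> l2 (fun n => u * x n + y n).
Proof.
move=> xl yl.
apply: (proj1 (l2_le_bounded (K := 2 * (sqmod u * l2norm2 x + l2norm2 y)) _)) => N.
apply: (@le_trans _ _ (\sum_(n < N) 2 * (sqmod u * sqmod (x n) + sqmod (y n)))).
  by apply: ler_sum => n _; rewrite -sqmodM; exact: sqmodD_le.
rewrite -mulr_sumr ler_pM2l // big_split /= -mulr_sumr lerD //.
  by rewrite ler_wpM2l ?sqmod_ge0 // l2_partial_le.
exact: l2_partial_le.
Qed.

Lemma l2_0 : l2 (fun=> 0 : C).
Proof.
apply: (proj1 (l2_le_bounded (K := 0) _)) => N.
by rewrite big1 // => n _; rewrite sqmod0.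
Qed.

End SquareSummable.

Section Blocks.
Variables (R : realType) (k : nat) (hk : (0 < k)%N).
Local Notation C := (R[i]).
Implicit Types (x : nat -> C) (X : 'I_k -> int -> C) (K : R).

Definition unblock X (n : nat) : C := X (pidx hk n) (n %/ k)%N%:Z.

Definition block x (j : 'I_k) (n : int) : C :=
  if n is Posz q then x (q * k + j)%N else 0.

Lemma blockK x n : unblock (block x) n = x n.
Proof. by rewrite /unblock /= -divn_eq. Qed.

Lemma pidx_block q (j : 'I_k) : pidx hk (q * k + j)%N = j.
Proof. by apply: val_inj; rewrite /= modnMDl modn_small. Qed.

Lemma divn_block q (j : 'I_k) : ((q * k + j) %/ k)%N = q.
Proof. by rewrite divnMDl // divn_small // addn0. Qed.

Lemma unblockE X q (j : 'I_k) : unblock X (q * k + j)%N = X j q%:Z.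
Proof. by rewrite /unblock pidx_block divn_block. Qed.

Lemma unblockK X j n : (forall j n, n < 0 -> X j n = 0) -> block (unblock X) j n = X j n.
Proof. by move=> X0; case: n => q; [exact: unblockE|rewrite /= X0]. Qed.

Lemma block_neg x j n : n < 0 -> block x j n = 0.
Proof. by case: n. Qed.

Lemma sum_blocks (f : nat -> R) N :
  \sum_(n < N * k) f n = \sum_(q < N) \sum_(j < k) f (q * k + j)%N.
Proof.
elim: N => [|N IH]; first by rewrite !big_ord0.
by rewrite mulSn addnC big_split_ord /= IH big_ord_recr.
Qed.

Lemma unblock_l2 X K : (forall j, l2Z_le (X j) K) ->
  l2 (unblock X) /\ l2norm2 (unblock X) <= k%:R * K.
Proof.
move=> XK; apply: l2_le_bounded => N.
have NNk : (N <= N * k)%N by rewrite leq_pmulr.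
apply: (@le_trans _ _ (\sum_(n < N * k) sqmod (unblock X n))).
  rewrite (big_ord_widen _ (fun n => sqmod (unblock X n)) NNk) big_mkcond /=.
  by apply: ler_sum => n _; case: ifP => // _; exact: sqmod_ge0.
rewrite (sum_blocks (fun n => sqmod (unblock X n))) exchange_big /=.
rewrite -[k in k%:R]card_ord mulr_natl -sumr_const; apply: ler_sum => j _.
have := XK j 0 N; congr (_ <= _); apply: eq_bigr => q _.
by rewrite unblockE add0r.
Qed.

Lemma block_l2Z x j : l2 x -> l2Z_le (block x j) (l2norm2 x).
Proof.
(* [lia] would otherwise make the lemma depend on [hk]. *)
clear hk => xl2 m N.
pose cut (n : int) : nat := if n is Posz q then q else 0%N.
pose f q := sqmod (x (q * k + j)%N).
have : \sum_(i < N) sqmod (block x j (m + i%:Z)) <= \sum_(q < cut (m + N%:Z)) f q.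
  elim: N => [|N IH].
    by rewrite big_ord0 sumr_ge0 // => q _; exact: sqmod_ge0.
  rewrite big_ord_recr /=; case E: (m + N%:Z) IH => [q|q] IH.
    have -> : m + N.+1%:Z = q.+1%:Z by lia.
    by rewrite /= big_ord_recr lerD.
  apply: le_trans (_ : 0 <= _); last by rewrite sumr_ge0 // => ? _; exact: sqmod_ge0.
  by rewrite [block _ _ _]/= sqmod0 addr0 (le_trans IH) //= big_ord0.
move=> /le_trans; apply; move: (cut _) => Q.
apply: le_trans (l2_partial_le (Q * k) xl2).
rewrite (sum_blocks (fun n => sqmod (x n))); apply: ler_sum => q _.
by rewrite (bigD1 j) //= lerDl sumr_ge0 // => ? _; exact: sqmod_ge0.
Qed.

End Blocks.

(** * The polynomial symbol *)

Section PolySymbol.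
Variables (R : realType) (m : nat) (hk : (0 < m.+1)%N).
Local Notation C := (R[i]).
Local Notation k := m.+1.
Variables (a b c : 'I_k -> C) (lam : C).
Implicit Types (X : 'I_k -> int -> C) (x : nat -> C).

(* [z * (symbol z - lam)] as a polynomial matrix in [z]. *)
Definition poly_symbol : 'M[{poly C}]_k :=
  map_mx polyC (Am1 b) + 'X *: map_mx polyC (A0 a b c - lam%:M) +
  'X^2 *: map_mx polyC (Ap1 c).

Definition shifted_toep x n : C := Toep hk a b c x n - lam * x n.

Lemma blockact_poly_symbol X i n : blockact poly_symbol X i n =
  \sum_j Am1 b i j * X j n + \sum_j A0 a b c i j * X j (n - 1) - lam * X i (n - 1) +
  \sum_j Ap1 c i j * X j (n - 2).
Proof.
clear hk; have -> : lam * X i (n - 1) = \sum_j lam *+ (i == j) * X j (n - 1).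
  rewrite (bigD1 i) //= eqxx big1 ?addr0 // => j ji.
  by rewrite eq_sym (negPf ji) mul0r.
rewrite -[X in _ = X + _]addrA -sumrB -!big_split /=; apply: eq_bigr => j _.
rewrite !mxE !actD -!['X * _]mulrC -!['X^2 * _]mulrC actMX actMXn !act_polyC.
by rewrite mulrBl.
Qed.

Lemma A0E i j : A0 a b c i j = (if j == i then a i else 0) +
  (if val j == (val i).+1 then b i else 0) + (if val i == (val j).+1 then c j else 0).
Proof.
rewrite mxE eq_sym -val_eqE /=.
by do 3 case: eqP => ?; rewrite ?addr0 ?add0r //; exfalso; lia.
Qed.


Lemma if0M (t : bool) (u v : C) : (if t then u else 0) * v = if t then u * v else 0.
Proof. by case: t; rewrite ?mul0r. Qed.

Lemma sum_if1 (P : pred 'I_k) (f : 'I_k -> C) j0 : P j0 -> (forall j, P j -> j = j0) ->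
  \sum_j (if P j then f j else 0) = f j0.
Proof.
move=> P0 P1; rewrite -big_mkcond /=; apply: big_only1 => // j ji Pj.
by rewrite (P1 j Pj) eqxx in ji.
Qed.

Lemma sum_if0 (P : pred 'I_k) (f : 'I_k -> C) : (forall j, ~~ P j) ->
  \sum_j (if P j then f j else 0) = 0.
Proof. by move=> P0; rewrite big1 // => j _; rewrite (negPf (P0 j)). Qed.

Lemma shifted_toep_unblock X n : shifted_toep (unblock hk X) n =
  blockact poly_symbol X (pidx hk n) (n %/ k).+1%:Z -
  (if n == 0%N then c ord_max * X ord_max (-1) else 0).
Proof.
have [i iE] : exists i, pidx hk n = i by exists (pidx hk n).
have [q qE] : exists q, (n %/ k)%N = q by exists (n %/ k)%N.
have nE : n = (q * k + i)%N by rewrite -iE -qE; exact: divn_eq.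
rewrite iE qE.
have q1 : q.+1%:Z - 1 = q%:Z by lia.
have q2 : q.+1%:Z - 2 = q%:Z - 1 by lia.
rewrite blockact_poly_symbol q1 q2.
have sumb : \sum_j Am1 b i j * X j q.+1%:Z +
    \sum_j (if val j == i.+1 then b i * X j q%:Z else 0) = b i * unblock hk X n.+1.
  have [ilast|ilast] := eqVneq (i : nat) m.
    have -> : n.+1 = (q.+1 * k + (ord0 : 'I_k))%N by rewrite nE ilast /=; lia.
    rewrite unblockE sum_if0 ?addr0; last first.
      by move=> j; rewrite ilast /=; have := ltn_ord j; lia.
    under eq_bigr do rewrite mxE if0M.
    rewrite (@sum_if1 _ (fun j => b i * X j q.+1%:Z) ord0) //=; first by rewrite ilast eqxx.
    by move=> j /andP[_ /eqP j0]; apply: val_inj.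
  have im : (i.+1 < k)%N by have := ltn_ord i; lia.
  have -> : n.+1 = (q * k + Ordinal im)%N by rewrite nE /=; lia.
  rewrite unblockE big1 ?add0r => [|j _]; last first.
    by rewrite mxE /= (negPf ilast) mul0r.
  rewrite (@sum_if1 _ (fun j => b i * X j q%:Z) (Ordinal im)) //= => j /eqP j0.
  exact: val_inj.
have sumc : \sum_j Ap1 c i j * X j (q%:Z - 1) +
    \sum_j (if val i == (val j).+1 then c j * X j q%:Z else 0) =
    (if n == 0%N then c ord_max * X ord_max (-1) else 0) +
    (if n is n'.+1 then c (pidx hk n') * unblock hk X n' else 0).
  have [i0|i0] := eqVneq (i : nat) 0%N.
    rewrite [X in _ + X]sum_if0 ?addr0; last by move=> j; rewrite /= i0.
    under eq_bigr do rewrite mxE if0M.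
    rewrite (@sum_if1 _ (fun j => c j * X j (q%:Z - 1)) ord_max) //=; last 2 first.
    - by rewrite i0 !eqxx.
    - by move=> j /andP[_ /eqP j0]; apply: val_inj.
    case: q nE {qE q1 q2 sumb} => [|q] nE; first by rewrite nE i0 addr0.
    pose n' := (q * k + (ord_max : 'I_k))%N.
    have -> : n = n'.+1 by rewrite nE i0 /n' /=; lia.
    by rewrite /= add0r /n' unblockE pidx_block; congr (_ * X _ _); lia.
  have im : (i.-1 < k)%N by have := ltn_ord i; lia.
  pose n' := (q * k + Ordinal im)%N.
  have -> : n = n'.+1 by rewrite nE /n' /=; lia.
  rewrite /= add0r /n' unblockE pidx_block big1 ?add0r => [|j _]; last first.
    by rewrite mxE /= (negPf i0) mul0r.
  rewrite (@sum_if1 _ (fun j => c j * X j q%:Z) (Ordinal im)) //=; first by lia.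
  by move=> j /eqP j0; apply: val_inj => /=; lia.
have sumA : \sum_j A0 a b c i j * X j q%:Z = a i * X i q%:Z +
    \sum_j (if val j == i.+1 then b i * X j q%:Z else 0) +
    \sum_j (if val i == (val j).+1 then c j * X j q%:Z else 0).
  rewrite -(@sum_if1 (pred1 i) (fun j => a i * X j q%:Z) i) //=; last by move=> j /eqP.
  rewrite -!big_split /=; apply: eq_bigr => j _; rewrite A0E !mulrDl.
  by congr (_ + _ + _); case: ifP => _; rewrite ?mul0r.
rewrite /shifted_toep /Toep iE sumA -sumb.
move: sumc => /(canRL (addKr _)) ->.
have -> : unblock hk X n = X i q%:Z by rewrite /unblock iE qE.
move: (if n == 0%N then _ else 0) (if n is n'.+1 then _ else 0) => t u.
by ring.
Qed.

End PolySymbol.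

Section SymbolDeterminant.
Variables (R : realType) (m : nat).
Local Notation C := (R[i]).
Local Notation k := m.+1.
Variables (a b c : 'I_k -> C) (lam : C).
Local Notation F := (poly_symbol a b c lam).

Definition quadratic (al be ga : C) : {poly C} := al%:P + be%:P * 'X + ga%:P * 'X^2.

Lemma horner_quadratic al be ga z :
  (quadratic al be ga).[z] = al + be * z + ga * z ^+ 2.
Proof. by rewrite /quadratic !hornerE. Qed.

Lemma det_poly_symbol : exists al be ga,
  \det F = quadratic al be ga * 'X^m /\ (al != 0 -> forall i, b i != 0).
Proof.
pose A := A0 a b c - lam%:M.
have [be E] := det_corner_perturbation A (c ord_max) (b ord_max).
exists (b ord_max * cofactor A ord_max ord0), be, (c ord_max * cofactor A ord0 ord_max).
split.
  rewrite -E /poly_symbol [X in \det (X + _)]addrC; congr (\det (_ + _ + _)).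
    apply/matrixP => i j; rewrite !mxE -!val_eqE /=.
    case: eqP => [im|_]; last by rewrite mulr0.
    have -> : i = ord_max by apply: val_inj.
    by case: eqP; rewrite ?mulr0 ?mulr1.
  apply/matrixP => i j; rewrite !mxE -!val_eqE /=.
  case: eqP => [_|_]; last by rewrite /= polyC0 !mulr0.
  case: eqP => [jm|_]; last by rewrite /= polyC0 !mulr0.
  have -> : j = ord_max by apply: val_inj.
  by rewrite mulr1.
rewrite mulf_eq0 negb_or /cofactor mulf_eq0 negb_or => /andP[bm /andP[_]].
rewrite det_trig; last first.
  apply/is_trig_mxP => i j /= ij; rewrite !mxE -!val_eqE /= /bump.
  have := ltn_ord i; have := ltn_ord j => /= jm im.
  rewrite leqNgt im add0n add1n; do 3 (case: eqP => [e|_]; first by exfalso; lia).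
  by rewrite mulr0n subr0.
move=> /prodf_neq0 bi i; have [->//|im] := eqVneq i ord_max.
have im' : (i < m)%N.
  by have := ltn_ord i; move: im; rewrite -val_eqE /=; lia.
have := bi (Ordinal im') isT; rewrite !mxE -!val_eqE /= /bump /=.
have -> : (m <= i)%N = false by lia.
rewrite !add0n add1n.
have -> : ((i : nat) == i.+1) = false by lia.
rewrite eqxx mulr0n subr0; congr (b _ != 0).
by apply: val_inj; rewrite /= /bump; lia.
Qed.

Lemma horner_det_poly_symbol z : z != 0 ->
  (\det F).[z] = z ^+ k * \det (symbol a b c z - lam%:M).
Proof.
move=> z0; rewrite -[LHS]/(horner_eval z (\det F)) -det_map_mx -detZ; congr (\det _).
apply/matrixP => i j; rewrite !mxE /= /horner_eval !hornerE.
by field.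
Qed.

Lemma det_symbol_quadratic al be ga z : \det F = quadratic al be ga * 'X^m -> z != 0 ->
  \det (symbol a b c z - lam%:M) = al / z + be + ga * z.
Proof.
move=> detE z0; have := horner_det_poly_symbol z0.
rewrite detE hornerM horner_quadratic hornerXn => E.
apply: (mulfI (expf_neq0 m z0)); apply: (mulfI z0).
by rewrite mulrA -exprS -E; field.
Qed.

Lemma adj_poly_symbol_last :
  (\adj F) ord_max ord_max = (\det (B0 a b c - lam%:M))%:P * 'X^m.
Proof.
rewrite mxE /cofactor addnn -signr_odd odd_double expr0 mul1r mulrC.
rewrite -det_map_mx -detZ; congr (\det _); apply/matrixP => i j.
have li (i' : 'I_m) : (lift ord_max i' : nat) = i'.
  by rewrite /= /bump; have := ltn_ord i'; lia.
have liE (i' : 'I_m) : lift ord_max i' = widen_ord (leq_pred k) i'.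
  by apply: val_inj; exact: li.
rewrite !mxE !liE -!val_eqE /=.
have -> : ((i : nat) == m) = false by have := ltn_ord i; lia.
have -> : ((j : nat) == m) = false by have := ltn_ord j; lia.
by rewrite andbF polyC0 mulr0 addr0 add0r.
Qed.

Lemma det_B0_eigenvalue : \det (B0 a b c - lam%:M) = 0 -> eigenvalue (B0 a b c) lam.
Proof.
move=> /eqP /det0P[v v0 vE]; apply/eigenvalueP; exists v => //.
by move/eqP: vE; rewrite mulmxBr mul_mx_scalar subr_eq0 => /eqP.
Qed.

End SymbolDeterminant.

Section Trichotomy.
Variable R : realType.
Local Notation C := (R[i]).
Implicit Types al be ga u v z r s kappa : C.

Variant quadratic_spec (p : {poly C}) : Prop :=
| QuadraticMixed kappa r s of kappa != 0 & sqmod r < 1 & sqmod s < 1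
    & p = mixed_quadratic kappa r s
| QuadraticOuter kappa r s of kappa != 0 & sqmod r < 1 & sqmod s < 1
    & p = outer_quadratic kappa r s
| QuadraticInner kappa r s of kappa != 0 & sqmod r < 1 & sqmod s < 1
    & p = inner_quadratic kappa r s.

Lemma quadratic_factor al be ga : exists u1 v1 u2 v2,
  [/\ ga = u1 * u2, be = u1 * v2 + u2 * v1 & al = v1 * v2].
Proof.
have [->|g0] := eqVneq ga 0.
  by exists be, al, 0, 1; rewrite mulr0 !mulr1 mul0r addr0.
pose d := sqrtc (be ^+ 2 - 4 * ga * al).
have dE : d ^+ 2 = be ^+ 2 - 4 * ga * al by exact: sqr_sqrtc.
exists ga, ((be - d) / 2), 1, ((be + d) / 2 / ga); split.
- by rewrite mulr1.
- by field; rewrite ?g0 ?pnatr_eq0.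
- have -> : (be - d) / 2 * ((be + d) / 2 / ga) = (be ^+ 2 - d ^+ 2) / (4 * ga).
    by field; rewrite ?g0 ?pnatr_eq0.
  by rewrite dE; field; rewrite ?g0 ?pnatr_eq0.
Qed.

Lemma linear_factor_dichotomy u v :
  (forall z, sqmod z = 1 -> u * z + v != 0) ->
  (exists kappa r, [/\ kappa != 0, sqmod r < 1, u = kappa & v = - kappa * r]) \/
  (exists kappa s, [/\ kappa != 0, sqmod s < 1, v = kappa & u = - kappa * s]).
Proof.
move=> nz.
have pos (w : C) : w != 0 -> 0 < sqmod w.
  move=> w0; rewrite lt_neqAle sqmod_ge0 andbT eq_sym.
  by apply: contra_neq w0; exact: sqmod_eq0.
case: (ltgtP (sqmod v) (sqmod u)) => [vu|uv|e].
- left; have u0 : u != 0.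
    by apply: contraTneq vu => ->; rewrite sqmod0 -leNgt sqmod_ge0.
  exists u, (- (v / u)); split=> //; last by field.
  by rewrite sqmodN sqmodM sqmodV ltr_pdivrMr ?pos // mul1r.
- right; have v0 : v != 0.
    by apply: contraTneq uv => ->; rewrite sqmod0 -leNgt sqmod_ge0.
  exists v, (- (u / v)); split=> //; last by field.
  by rewrite sqmodN sqmodM sqmodV ltr_pdivrMr ?pos // mul1r.
- exfalso; have [u0|u0] := eqVneq u 0.
    have v0 : v = 0 by apply: sqmod_eq0; rewrite e u0 sqmod0.
    by have /eqP := nz 1 (sqmod1 R); rewrite u0 v0 mul0r addr0.
  have : sqmod (- (v / u)) = 1.
    by rewrite sqmodN sqmodM sqmodV e divff // gt_eqF // pos.
  by move=> /nz /eqP; apply; field.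
Qed.

Lemma quadraticP al be ga :
  (forall z, sqmod z = 1 -> al + be * z + ga * z ^+ 2 != 0) ->
  quadratic_spec (quadratic al be ga).
Proof.
have [u1 [v1 [u2 [v2 [-> -> ->]]]]] := quadratic_factor al be ga => nz.
have nz' z : sqmod z = 1 -> (u1 * z + v1) * (u2 * z + v2) != 0.
  by move=> /nz; congr (_ != 0); ring.
have nz1 z : sqmod z = 1 -> u1 * z + v1 != 0.
  by move=> /nz'; rewrite mulf_eq0 negb_or => /andP[].
have nz2 z : sqmod z = 1 -> u2 * z + v2 != 0.
  by move=> /nz'; rewrite mulf_eq0 negb_or => /andP[].
rewrite /quadratic.
case: (linear_factor_dichotomy nz1) => -[k1 [r [k10 r1 -> ->]]];
  case: (linear_factor_dichotomy nz2) => -[k2 [s [k20 s1 -> ->]]].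
- apply: (@QuadraticInner _ (k1 * k2) r s) => //; first by rewrite mulf_neq0.
  by rewrite /inner_quadratic !(rmorphD, rmorphM, rmorphN) /=; ring.
- apply: (@QuadraticMixed _ (k1 * k2) r s) => //; first by rewrite mulf_neq0.
  by rewrite /mixed_quadratic !(rmorphD, rmorphM, rmorphN) /=; ring.
- apply: (@QuadraticMixed _ (k1 * k2) s r) => //; first by rewrite mulf_neq0.
  by rewrite /mixed_quadratic !(rmorphD, rmorphM, rmorphN) /=; ring.
- apply: (@QuadraticOuter _ (k1 * k2) r s) => //; first by rewrite mulf_neq0.
  by rewrite /outer_quadratic !(rmorphD, rmorphM, rmorphN) /=; ring.
Qed.

End Trichotomy.

(** * Winding numbers *)

Section Winding.
Variable R : realType.
Local Notation C := (R[i]).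
Implicit Types (gamma : R -> C) (theta : R -> R).

Lemma expitD (s t : R) : expit (s + t) = expit s * expit t.
Proof. by rewrite /expit cosD sinD /=; congr Complex; ring. Qed.

Lemma expit0 : expit (0 : R) = 1.
Proof. by rewrite /expit cos0 sin0. Qed.

Lemma sqmod_expit (t : R) : sqmod (expit t) = 1.
Proof. exact: cos2Dsin2. Qed.

Lemma expit_neq0 (t : R) : expit t != 0.
Proof.
apply/eqP => e; have := sqmod_expit t; rewrite e sqmod0 => /eqP.
by rewrite eq_sym oner_eq0.
Qed.

Lemma expitN (t : R) : expit (- t) = (expit t)^-1.
Proof.
by apply: (mulfI (expit_neq0 t)); rewrite -expitD subrr expit0 divff ?expit_neq0.
Qed.

Lemma expit_2pi : expit (2 * pi) = 1 :> C.
Proof. by rewrite /expit mulr_natl cos2pi sin2pi. Qed.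

Definition has_arg gamma theta : Prop :=
  forall t, exists r : R, 0 < r /\ gamma t = r%:C * expit (theta t).

Lemma has_argM gamma gamma' theta theta' :
  has_arg gamma theta -> has_arg gamma' theta' ->
  has_arg (fun t => gamma t * gamma' t) (fun t => theta t + theta' t).
Proof.
move=> g g' t; have [r [r0 ->]] := g t; have [r' [r0' ->]] := g' t.
by exists (r * r'); rewrite mulr_gt0 // expitD rmorphM mulrACA.
Qed.

Lemma right_half_plane_polar (x y : R) : 0 < x ->
  exists r : R, 0 < r /\ x +i* y = r%:C * expit (atan (y / x)).
Proof.
move=> x0; pose q := Num.sqrt (1 + (y / x) ^+ 2).
have q0 : 0 < q by rewrite sqrtr_gt0 ltr_wpDr // sqr_ge0.
exists (x * q); split; first exact: mulr_gt0.
have c0 : cos (atan (y / x)) = q^-1 by exact: cos_atan.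
have s0 : sin (atan (y / x)) = y / x / q.
  have cn : cos (atan (y / x)) != 0 by rewrite c0 invr_eq0 gt_eqF.
  by rewrite -[X in X / q](atanK (y / x)) /tan -c0 mulfVK.
rewrite /expit c0 s0 /=; congr Complex; last by field; rewrite !gt_eqF.
by rewrite mul0r subr0 mulfK // gt_eqF.
Qed.

Lemma polar (z : C) : z != 0 -> exists (phi r : R), 0 < r /\ z = r%:C * expit phi.
Proof.
case: z => x y z0.
have half (x' y' d : R) : 0 < x' -> x +i* y = expit d * (x' +i* y') ->
    exists (phi r : R), 0 < r /\ x +i* y = r%:C * expit phi.
  move=> /(right_half_plane_polar y')[r [r0 ->]] ->.
  by exists (d + atan (y' / x')), r; rewrite expitD mulrCA.
case: (ltgtP 0 x) => [x0|x0|x0].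
- by apply: (half x y 0) => //; rewrite expit0 mul1r.
- apply: (half (- x) (- y) pi); first by rewrite oppr_gt0.
  by rewrite /expit cospi sinpi /=; congr Complex; ring.
case: (ltgtP 0 y) => [y0|y0|y0].
- apply: (half y 0 (pi / 2)) => //.
  by rewrite /expit cos_pihalf sin_pihalf /= -x0; congr Complex; ring.
- apply: (half (- y) 0 (- (pi / 2))); first by rewrite oppr_gt0.
  by rewrite /expit cosN sinN cos_pihalf sin_pihalf /= -x0; congr Complex; ring.
by rewrite -x0 -y0 eqxx in z0.
Qed.

Lemma near_one_arg (r : C) (e : R) : sqmod r < 1 -> expit (e * (2 * pi)) = 1 :> C ->
  exists theta, [/\ continuous theta, theta (2 * pi) = theta 0 &
    has_arg (fun t => 1 - r * expit (e * t)) theta].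
Proof.
case: r => r1 r2 rlt e1.
pose u t := 1 - (r1 * cos (e * t) - r2 * sin (e * t)).
pose v t := - (r1 * sin (e * t) + r2 * cos (e * t)).
have u0 t : 0 < u t.
  rewrite subr_gt0; have := cos2Dsin2 (e * t).
  move: (cos _) (sin _) rlt => ct st /= rlt cs.
  have : (r1 * ct - r2 * st) ^+ 2 < 1.
    have -> : (r1 * ct - r2 * st) ^+ 2 =
        (r1 ^+ 2 + r2 ^+ 2) * (ct ^+ 2 + st ^+ 2) - (r1 * st + r2 * ct) ^+ 2 by ring.
    by rewrite cs mulr1 (le_lt_trans _ rlt) // gerBl sqr_ge0.
  by move: (_ - _) => x x2; nra.
have cu : continuous u.
  move=> t; rewrite /u; apply: cvgB; first exact: cvg_cst.
  by apply: cvgB; apply: cvgM; try exact: cvg_cst;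
    apply: (@continuous_comp _ _ _ (fun t => e * t));
    [exact: mulrl_continuous|exact: continuous_cos|exact: mulrl_continuous|exact: continuous_sin].
have cv : continuous v.
  move=> t; rewrite /v; apply: cvgN.
  by apply: cvgD; apply: cvgM; try exact: cvg_cst;
    apply: (@continuous_comp _ _ _ (fun t => e * t));
    [exact: mulrl_continuous|exact: continuous_sin|exact: mulrl_continuous|exact: continuous_cos].
exists (fun t => atan (v t / u t)); split.
- move=> t; apply: (@continuous_comp _ _ _ (fun t => v t / u t)); last exact: continuous_atan.
  apply: cvgM; first exact: cv.
  by apply: cvgV; [rewrite gt_eqF|exact: cu].
- by rewrite /u /v mulr0 cos0 sin0; move: e1; rewrite /expit => -[-> ->].
- move=> t; have [rr [rr0 E]] := right_half_plane_polar (v t) (u0 t).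
  exists rr; split => //; rewrite -E /expit /u /v /=; congr Complex; ring.
Qed.

Lemma winding_number_factored gamma (kappa r s : C) (e e' d : R) :
  kappa != 0 -> sqmod r < 1 -> sqmod s < 1 ->
  expit (e * (2 * pi)) = 1 :> C -> expit (e' * (2 * pi)) = 1 :> C ->
  (forall t, gamma t =
    kappa * expit (d * t) * (1 - r * expit (e * t)) * (1 - s * expit (e' * t))) ->
  winding_number gamma d.
Proof.
move=> /polar[phi [rho [rho0 kE]]] r1 s1 e1 e1' gE.
have [th1 [c1 p1 a1]] := near_one_arg r1 e1.
have [th2 [c2 p2 a2]] := near_one_arg s1 e1'.
exists (fun t => phi + d * t + th1 t + th2 t); split; [|split].
- apply: continuous_subspaceT => t; apply: cvgD; last exact: c2.
  apply: cvgD; last exact: c1.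
  by apply: cvgD; [exact: cvg_cst|exact: mulrl_continuous].
- move=> t _; rewrite gE.
  have h : has_arg (fun t => kappa * expit (d * t)) (fun t => phi + d * t).
    by move=> {}t; exists rho; rewrite kE expitD mulrA.
  exact: (has_argM (has_argM h a1) a2 t).
- have pi0 : pi != 0 :> R by rewrite gt_eqF // pi_gt0.
  rewrite /= p1 p2; move: (pi : R) pi0 => p p0.
  by field; rewrite p0.
Qed.

Lemma expit_constant (f : R -> R) : {within `[0, 2 * pi], continuous f}%classic ->
  (forall t, t \in `[0, 2 * pi] -> expit (f t) = 1) -> f (2 * pi) <= f 0.
Proof.
move=> cf fE; rewrite leNgt; apply/negP => lt_f.
have pi0 := pi_gt0 R.
have b0 : 0 <= 2 * pi :> R by rewrite mulr_ge0 // ltW.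
pose d := Num.min (f (2 * pi) - f 0) pi.
have d0 : 0 < d by rewrite lt_min subr_gt0 lt_f.
have dpi : d <= pi by rewrite ge_min lexx orbT.
have dv : f 0 + d <= f (2 * pi) by rewrite -lerBrDl ge_min lexx.
have [t tI ft] : exists2 t, t \in `[0, 2 * pi] & f t = f 0 + d.
  apply: IVT => //; rewrite min_l ?max_r ?(ltW lt_f) //.
  by rewrite dv andbT lerDl ltW.
have := fE t tI; rewrite ft expitD fE ?mul1r; last by rewrite in_itv /= lexx.
rewrite /expit => -[cd _].
have := ltr_cos (x := 0) (y := d); rewrite !in_itv /= lexx (ltW pi0) (ltW d0) dpi.
by move=> /(_ isT isT); rewrite cos0 cd ltxx d0.
Qed.

Lemma winding_number_unique gamma w1 w2 :
  winding_number gamma w1 -> winding_number gamma w2 -> w1 = w2.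
Proof.
move=> [th1 [c1 [a1 ->]]] [th2 [c2 [a2 ->]]].
have diff (f g : R -> R) : {within `[0, 2 * pi], continuous f}%classic ->
    {within `[0, 2 * pi], continuous g}%classic ->
    (forall t, t \in `[0, 2 * pi] ->
      exists r : R, 0 < r /\ gamma t = r%:C * expit (f t)) ->
    (forall t, t \in `[0, 2 * pi] ->
      exists r : R, 0 < r /\ gamma t = r%:C * expit (g t)) ->
    f (2 * pi) - g (2 * pi) <= f 0 - g 0.
  move=> cf cg af ag; apply: (@expit_constant (fun t => f t - g t)).
    by move=> t; apply: cvgB; [exact: cf|exact: cg].
  move=> t tI; have [r [r0 E]] := af t tI; have [r' [r0' E']] := ag t tI.
  have sqC (x : R) : sqmod x%:C = x ^+ 2 by rewrite /sqmod /= expr0n addr0.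
  have rr : r = r'.
    apply/eqP; rewrite -(eqrXn2 (n := 2)) ?ltW //; apply/eqP.
    have := congr1 (@sqmod R) (etrans (esym E) E').
    by rewrite !sqmodM !sqmod_expit !mulr1 !sqC.
  have rC : r%:C != 0 by rewrite eq_complex /= eqxx andbT gt_eqF.
  rewrite expitD expitN; apply: (mulfI rC).
  by rewrite mulrA -E E' -rr mulfK ?expit_neq0 // mulr1.
have l1 := diff _ _ c1 c2 a1 a2; have l2 := diff _ _ c2 c1 a2 a1.
by congr (_ / _); lra.
Qed.

End Winding.

(** * The mixed case: invertibility *)

Section InvertibilityCriterion.
Variable R : realType.
Local Notation C := (R[i]).

Lemma invertible_op_criterion (A : (nat -> C) -> (nat -> C)) (M : R) :
  (forall x, l2 x -> l2 (A x)) ->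
  (forall (u : C) x y, A (fun n => u * x n + y n) = (fun n => u * A x n + A y n)) ->
  (forall x, l2 x -> A x = (fun=> 0) -> x = (fun=> 0)) ->
  (forall y, l2 y -> exists x, [/\ l2 x, A x = y & l2norm2 x <= M * l2norm2 y]) ->
  invertible_op A.
Proof.
move=> A2 Alin Ainj Asurj.
have /choice[S SP] : forall y, exists x, l2 y ->
    [/\ l2 x, A x = y & l2norm2 x <= M * l2norm2 y].
  move=> y; have [/Asurj[x Hx]|ny] := pselect (l2 y); first by exists x.
  by exists y.
have S2 y : l2 y -> l2 (S y) by case/SP.
have SK y : l2 y -> A (S y) = y by case/SP.
have inj x y : l2 x -> l2 y -> A x = A y -> x = y.
  move=> x2 y2 e.
  have E : (fun n => -1 * y n + x n) = (fun=> 0).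
    apply: Ainj; first exact: l2_comb.
    by rewrite Alin e; apply/funext => n; rewrite mulN1r addNr.
  apply/funext => n; have /eqP := congr1 (@^~ n) E.
  by rewrite mulN1r addrC subr_eq0 => /eqP.
exists S; split; [split; [exact: S2|split]|split].
- move=> u x y x2 y2; apply: inj; first by apply: S2; exact: l2_comb.
    by apply: l2_comb; exact: S2.
  by rewrite Alin !SK //; exact: l2_comb.
- by exists M => y y2; case: (SP y y2).
- by move=> x x2; apply: inj => //; [apply: S2; exact: A2|rewrite SK //; exact: A2].
- exact: SK.
Qed.

End InvertibilityCriterion.

Section ToeplitzBlocks.
Variables (R : realType) (m : nat) (hk : (0 < m.+1)%N).
Local Notation C := (R[i]).
Local Notation k := m.+1.
Variables (a b c : 'I_k -> C) (lam : C).
Implicit Types (X W : 'I_k -> int -> C) (x : nat -> C).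
Local Notation F := (poly_symbol a b c lam).
Local Notation T := (shifted_toep hk a b c lam).

Definition last_delta (j : 'I_k) (n : int) : C := (j == ord_max)%:R * delta R (-1) n.

Lemma l2Z_last_delta j : l2Z_le (last_delta j) 1.
Proof.
apply: l2Z_le_weak (l2Z_leZ _ (l2Z_le_delta R (-1))).
by rewrite mulr1; case: eqP; rewrite ?sqmod1 ?sqmod0.
Qed.

Lemma shifted_toep_comb (u : C) x y :
  T (fun n => u * x n + y n) = (fun n => u * T x n + T y n).
Proof. by apply/funext => n; rewrite /shifted_toep /Toep; case: n => [|n]; ring. Qed.

Lemma shifted_toep_block x :
  T x = unblock hk (fun i n => blockact F (block x) i (n + 1)).
Proof.
apply/funext => n.
rewrite -[in LHS](funext (blockK hk x)) shifted_toep_unblock mulr0 if_same subr0.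
by rewrite /unblock; congr (blockact _ _ _ _); lia.
Qed.

Lemma shifted_toep_l2 x : l2 x -> l2 (T x).
Proof.
move=> x2; have [M M0 HM] := blockact_l2Z F; rewrite shifted_toep_block.
apply: (proj1 (unblock_l2 hk (K := M * l2norm2 x) _)) => j.
by apply: (l2Z_le_shift 1); apply: HM => i; exact: block_l2Z.
Qed.

Lemma blockact_kernel x i n : T x = (fun=> 0) ->
  blockact F (block x) i (n + 1) = b ord_max * x 0%N * last_delta i n.
Proof.
rewrite shifted_toep_block => Tx.
have zero (j : 'I_k) (t : int) : t < 0 -> block x j t = 0 by exact: block_neg.
case: n => q.
  have := congr1 (@^~ (q * k + i)%N) Tx; rewrite (unblockE hk) => ->.
  by rewrite /last_delta /delta /= !mulr0.
rewrite blockact_poly_symbol.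
rewrite (_ : \sum_j A0 a b c i j * _ = 0); last first.
  by rewrite big1 // => j _; rewrite zero ?mulr0 //; lia.
rewrite (_ : \sum_j Ap1 c i j * _ = 0); last first.
  by rewrite big1 // => j _; rewrite zero ?mulr0 //; lia.
rewrite zero ?mulr0 ?subr0 ?addr0; last by lia.
case: q => [|q]; last first.
  rewrite big1 => [|j _]; last by rewrite zero ?mulr0 //; lia.
  by rewrite /last_delta /delta !mulr0.
rewrite (bigD1 ord0) //= big1 ?addr0 => [|j j0]; last first.
  rewrite mxE (_ : (\val j == 0%N) = false) ?andbF ?mul0r //.
  by apply: contraNF j0 => /eqP j0; apply/eqP/val_inj.
rewrite mxE /last_delta /delta -val_eqE /= andbT mulr1 mul0n.
by case: eqP => [im|_]; rewrite ?mul0r ?mulr0 // mulr1; congr (b _ * _); apply: val_inj.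
Qed.

Variable p : {poly C}.
Hypothesis detE : \det F = p * 'X^m.

Definition adj_block W i n := blockact (\adj F) W i (n + (m%:Z - 1)).

Lemma blockact_adj_block W i n : blockact F (adj_block W) i (n + 1) = act p (W i) n.
Proof.
clear hk; rewrite blockact_shift -blockactM mul_mx_adj detE blockact_scalar actMXn.
by congr (act _ _ _); lia.
Qed.

Lemma act_blockact X i n :
  act p (X i) n = blockact (\adj F) (blockact F X) i (n + m%:Z).
Proof. by rewrite -blockactM mul_adj_mx detE blockact_scalar actMXn addrK. Qed.

End ToeplitzBlocks.

Section MixedCase.
Variables (R : realType) (m : nat) (hk : (0 < m.+1)%N).
Local Notation C := (R[i]).
Local Notation k := m.+1.
Variables (a b c : 'I_k -> C) (lam : C).
Local Notation F := (poly_symbol a b c lam).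
Local Notation T := (shifted_toep hk a b c lam).
Variables kappa r s : C.
Hypotheses (kappa0 : kappa != 0) (r1 : sqmod r < 1) (s1 : sqmod s < 1).
Local Notation p := (mixed_quadratic kappa r s).
Hypothesis detE : \det F = p * 'X^m.
Hypothesis B0_unit : \det (B0 a b c - lam%:M) != 0.

Lemma mixed_block_solve : exists2 M : R, 0 <= M & forall Y K,
  (forall i : 'I_k, l2Z_le (Y i) K) -> exists2 W, forall i, l2Z_le (W i) (M * K) &
    forall i n, act p (W i) n = Y i n.
Proof.
have [M M0 HM] := mixed_solve kappa0 r1 s1.
exists M => // Y K YK.
have /choice[W WP] : forall i : 'I_k, exists w, l2Z_le w (M * K) /\
    forall n, act p w n = Y i n.
  by move=> i; have [w w1 w2] := HM _ _ (YK i); exists w.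
by exists W => i; case: (WP i).
Qed.

(* The column of the bilateral inverse indexed by the site just left of the
   half-line; its diagonal entry is where [B0] enters. *)
Lemma boundary_column : exists (U : 'I_k -> int -> C) (K : R),
  [/\ forall i, l2Z_le (U i) K,
      forall i n, blockact F U i (n + 1) = last_delta R i n & U ord_max (-1) != 0].
Proof.
clear hk; have [M M0 /(_ _ _ (@l2Z_last_delta R m))[W WK WE]] := mixed_block_solve.
have [Ma Ma0 HMa] := blockact_l2Z (\adj F).
exists (adj_block a b c lam W), (Ma * (M * 1)); split.
- by move=> i; apply: l2Z_le_shift; exact: HMa.
- by move=> i n; rewrite (blockact_adj_block detE).
have W0 j : j != ord_max -> W j = fun=> 0.
  move=> jm; apply/funext; apply: (mixed_unique kappa0 r1 s1 (K := M * 1)).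
    by move=> n; exact: l2Z_le_pt.
  by move=> n; rewrite WE /last_delta (negPf jm) mul0r.
rewrite /adj_block /blockact (bigD1 ord_max) //= big1 ?addr0 => [|j jm]; last first.
  by rewrite W0 // act0r.
rewrite adj_poly_symbol_last actMXn act_polyC mulf_neq0 //.
have -> : -1 + (m%:Z - 1) - m%:Z = -1 - 1 by lia.
apply/eqP; apply: (mixed_fundamental_neq0 kappa0 r1 s1 (K := M * 1)).
  by move=> n; exact: l2Z_le_pt.
by move=> n; rewrite WE /last_delta eqxx mul1r.
Qed.

Lemma mixed_invertible : invertible_op T.
Proof.
have [U [KU [UK UE U0]]] := boundary_column.
have [M M0 HM] := mixed_block_solve.
have [Ma Ma0 HMa] := blockact_l2Z (\adj F).
pose v := (U ord_max (-1))^-1.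
pose L := 2 * (Ma * M + sqmod v * (Ma * M) * KU).
apply: (@invertible_op_criterion _ _ (k%:R * L)).
- exact: shifted_toep_l2.
- exact: shifted_toep_comb.
- move=> x x2 Tx.
  have E i n : block x i n = b ord_max * x 0%N * U i n.
    apply/eqP; rewrite -subr_eq0; apply/eqP.
    pose w := b ord_max * x 0%N.
    pose D (i : 'I_k) (n : int) := block x i n + - w * U i n.
    have <- : D i n = block x i n - w * U i n by rewrite /D mulNr.
    apply: (mixed_unique kappa0 r1 s1 (K := 2 * (l2norm2 x + sqmod (- w) * KU))).
      move=> j; apply: le_trans (sqmodD_le _ _) _; rewrite ler_pM2l // lerD //.
        by apply: l2Z_le_pt; exact: block_l2Z.
      by rewrite sqmodM ler_wpM2l ?sqmod_ge0 //; exact: l2Z_le_pt.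
    move=> j; rewrite (act_blockact detE).
    rewrite (@eq_blockact _ _ _ _ (fun _ _ => 0)).
      by rewrite /blockact big1 // => l _; rewrite act0r.
    move=> l t; rewrite blockact_comb -(subrK 1 t) (blockact_kernel _ _ Tx) UE.
    by rewrite -/w mulNr subrr.
  have w0 : b ord_max * x 0%N = 0.
    have /eqP := E ord_max (-1); rewrite [block _ _ _]/= eq_sym mulf_eq0 (negPf U0) orbF.
    by move/eqP.
  by apply/funext => n; rewrite -(blockK hk x n) /unblock E w0 mul0r.
- move=> y y2.
  have [W WK WE] := HM _ _ (fun i => block_l2Z i y2).
  pose G := adj_block a b c lam W.
  have GK i : l2Z_le (G i) (Ma * (M * l2norm2 y)).
    by apply: l2Z_le_shift; exact: HMa.
  pose t := - (G ord_max (-1) * v).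
  pose X i n := G i n + t * U i n.
  have XK i : l2Z_le (X i) (L * l2norm2 y).
    apply: l2Z_le_weak (l2Z_leD (GK i) (l2Z_leZ t (UK i))).
    have : sqmod t <= sqmod v * (Ma * (M * l2norm2 y)).
      rewrite /t sqmodN sqmodM mulrC ler_wpM2l ?sqmod_ge0 //; exact: l2Z_le_pt.
    have KU0 := l2Z_le_ge0 (UK ord_max).
    move=> /(ler_wpM2r KU0) le; rewrite /L -!mulrA ler_pM2l // mulrDl.
    by rewrite !mulrA in le *; rewrite lerD2l (le_trans le) // mulrAC.
  have [X2 Xn] := unblock_l2 hk XK.
  exists (unblock hk X); split => //; last by rewrite -mulrA.
  apply/funext => n; rewrite shifted_toep_unblock.
  have -> : (n %/ k).+1%:Z = (n %/ k)%N%:Z + 1 by lia.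
  rewrite blockact_comb (blockact_adj_block detE) WE UE -(blockK hk y n) /unblock.
  have -> : last_delta R (pidx hk n) (n %/ k)%N = 0 by rewrite /last_delta mulr0.
  rewrite mulr0 addr0 (_ : X ord_max (-1) = 0) ?mulr0 ?if_same ?subr0 //.
  by rewrite /X /t /v mulNr mulfVK // subrr.
Qed.

End MixedCase.

(** * Obstructions to invertibility *)

Section Obstructions.
Variables (R : realType) (m : nat) (hk : (0 < m.+1)%N).
Local Notation C := (R[i]).
Local Notation k := m.+1.
Implicit Types (a b c : 'I_k -> C) (lam kappa r s : C) (x y : nat -> C).

Fixpoint kernel_pair a b c lam n : C * C :=
  if n is n'.+1 then
    let: (u, v) := kernel_pair a b c lam n' in
    (v, - (c (pidx hk n'.-1) * u + (a (pidx hk n') - lam) * v) / b (pidx hk n'))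
  else (0, 1).

Lemma kernel_pair_toep a b c lam : (forall i, b i != 0) ->
  shifted_toep hk a b c lam (fun n => (kernel_pair a b c lam n).2) = (fun=> 0).
Proof.
move=> b0; apply/funext => n; rewrite /shifted_toep /Toep.
have := b0 (pidx hk n); case: n => [|n] /= bn; first by field.
case: (kernel_pair a b c lam n) => u v /=.
move: (- _ / b (pidx hk n)) => w; by field.
Qed.

(* Both characteristic roots of the block recursion lie in the unit disc, so
   every half-line solution is square summable. *)
Lemma outer_kernel a b c lam kappa r s :
  kappa != 0 -> sqmod r < 1 -> sqmod s < 1 -> (forall i, b i != 0) ->
  \det (poly_symbol a b c lam) = outer_quadratic kappa r s * 'X^m ->
  exists x, [/\ l2 x, x 0%N = 1 & shifted_toep hk a b c lam x = (fun=> 0)].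
Proof.
move=> kappa0 r1 s1 b0 detE.
pose x n := (kernel_pair a b c lam n).2.
have Tx : shifted_toep hk a b c lam x = (fun=> 0) by exact: kernel_pair_toep.
exists x; split => //.
pose F := poly_symbol a b c lam.
have [Ma Ma0 HMa] := blockact_l2Z (\adj F).
have FK j : l2Z_le (blockact F (block x) j) (sqmod (b ord_max * x 0%N) * 1).
  have -> : blockact F (block x) j =
      fun n => b ord_max * x 0%N * last_delta R j (n - 1).
    apply/funext => n; rewrite -(blockact_kernel _ _ Tx).
    by rewrite subrK.
  exact: (l2Z_leZ _ (l2Z_le_shift (-1) (l2Z_last_delta R j))).
have xK (i : 'I_k) : exists K, l2Z_le (block x i) K.
  have zK := l2Z_le_shift m%:Z (HMa _ _ FK i).
  apply: (outer_l2Z kappa0 r1 s1 zK).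
    by move=> n; exact: block_neg.
  by move=> n; rewrite (act_blockact detE).
have [K KP] := choice xK.
have K0 j : 0 <= K j by exact: l2Z_le_ge0 (KP j).
rewrite -(funext (blockK hk x)).
apply: (proj1 (unblock_l2 hk (K := \sum_j K j) _)) => j.
apply: l2Z_le_weak (KP j); rewrite (bigD1 j) //= lerDl.
by rewrite sumr_ge0.
Qed.

Lemma kernel_not_invertible (A : (nat -> C) -> (nat -> C)) x :
  l2 x -> A x = (fun=> 0) -> x 0%N = 1 -> ~ invertible_op A.
Proof.
move=> x2 Ax x0 [S [[_ [Slin _]] [SA _]]].
have S0 : S (fun=> 0) 0%N = 0.
  have E : (fun _ : nat => -1 * 0 + 0 : C) = (fun=> 0).
    by apply/funext => n; rewrite mulr0 addr0.
  have := Slin (-1) _ _ (@l2_0 R) (@l2_0 R); rewrite E => /(congr1 (@^~ 0%N)) ->.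
  by rewrite mulN1r addNr.
have := SA x x2; rewrite Ax => E; move: S0; rewrite E x0 => /eqP.
by rewrite oner_eq0.
Qed.

Lemma bounded_multiples (e K : R) : (forall N : nat, N%:R * e <= K) -> e <= 0.
Proof.
move=> NK; rewrite leNgt; apply/negP => e0.
have := NK (Num.bound `|K / e|); rewrite -ler_pdivlMr // leNgt => /negP; apply.
apply: le_lt_trans (ler_norm _) _.
exact: archi_boundP.
Qed.

(* Lagrange's identity for the tridiagonal operator and its transpose. *)
Lemma toep_lagrange a b c lam x y N :
  \sum_(n < N.+1) (shifted_toep hk a b c lam y n * x n -
                   y n * shifted_toep hk a c b lam x n) =
  b (pidx hk N) * y N.+1 * x N - c (pidx hk N) * y N * x N.+1.
Proof.
elim: N => [|N IH]; first by rewrite big_ord1 /shifted_toep /Toep /=; ring.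
by rewrite big_ord_recr IH /shifted_toep /Toep /=; ring.
Qed.

Lemma transpose_kernel_not_invertible a b c lam x :
  l2 x -> x 0%N = 1 -> shifted_toep hk a c b lam x = (fun=> 0) ->
  ~ invertible_op (shifted_toep hk a b c lam).
Proof.
move=> x2 x0 Tx [S [[S2 _] [_ AS]]].
pose e0 (n : nat) : C := (n == 0%N)%:R.
have e02 : l2 e0.
  apply: (proj1 (l2_le_bounded (K := 1) _)) => -[|N]; first by rewrite big_ord0 ler01.
  rewrite big_ord_recl (sqmod1 R : sqmod (e0 0%N) = 1) big1 ?addr0 // => i _.
  exact: sqmod0.
pose y := S e0; have y2 : l2 y by exact: S2.
have Ty : shifted_toep hk a b c lam y = e0 by exact: AS.
pose B := \sum_i (sqmod (b i) + sqmod (c i)).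
have BP i : sqmod (b i) <= B /\ sqmod (c i) <= B.
  have le_B : sqmod (b i) + sqmod (c i) <= B.
    by rewrite /B (bigD1 i) //= lerDl sumr_ge0 // => j _; rewrite addr_ge0 ?sqmod_ge0.
  by split; apply: le_trans le_B; rewrite ?lerDl ?lerDr sqmod_ge0.
have B_ge0 : 0 <= B by rewrite sumr_ge0 // => i _; rewrite addr_ge0 ?sqmod_ge0.
have Y0 := l2norm2_ge0 y2.
have one N : 1 <= 2 * (B * l2norm2 y * (sqmod (x N) + sqmod (x N.+1))).
  have E : b (pidx hk N) * y N.+1 * x N - c (pidx hk N) * y N * x N.+1 = 1.
    rewrite -(toep_lagrange a b c lam) Ty Tx.
    rewrite big_ord_recl /e0 /= x0 mulr0 subr0 mulr1 big1 ?addr0 // => i _.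
    by rewrite mul0r mulr0 subr0.
  rewrite -[leLHS](sqmod1 R) -E; apply: le_trans (sqmodD_le _ _) _; rewrite ler_pM2l // mulrDr.
  rewrite sqmodN !sqmodM; apply: lerD; rewrite ler_wpM2r ?sqmod_ge0 //.
    by apply: ler_pM; rewrite ?sqmod_ge0 ?(BP _).1 // l2_pt_le.
  by apply: ler_pM; rewrite ?sqmod_ge0 ?(BP _).2 // l2_pt_le.
have : (1 : R) <= 0; last by rewrite ler10.
apply: (@bounded_multiples _ (2 * (B * l2norm2 y * (2 * l2norm2 x)))) => N.
rewrite mulr_natl -[N in _ *+ N]card_ord -sumr_const.
apply: le_trans (ler_sum _ (fun (i : 'I_N) _ => one i)) _.
rewrite -mulr_sumr ler_pM2l // -mulr_sumr ler_wpM2l ?mulr_ge0 // big_split /=.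
rewrite mulr_natl mulr2n lerD ?l2_partial_le //.
have := l2_partial_le N.+1 x2; rewrite big_ord_recl; apply: le_trans.
by rewrite lerDr sqmod_ge0.
Qed.

Lemma act_delta0 (q : {poly C}) (n : nat) : act q (delta R 0) n%:Z = q`_n.
Proof.
rewrite (@act_widen _ (maxn (size q) n.+1)) ?leq_maxl //.
have nm : (n < maxn (size q) n.+1)%N by rewrite leq_max ltnSn orbT.
rewrite (bigD1 (Ordinal nm)) //= /delta subrr eqxx mulr1 big1 ?addr0 // => j jn.
rewrite subr_eq0 (_ : (n%:Z == j%:Z) = false) ?mulr0 //.
by apply: contraNF jn => /eqP e; apply/eqP; apply: val_inj => /=; lia.
Qed.

(* Truncations of the generalized eigenvector [z^-n v]: their norms grow while
   the telescoping product [('X - z) * (1 + 'X/z + ...)] keeps the images bounded. *)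
Lemma sigma_det_not_invertible a b c lam : sigma_det a b c lam ->
  ~ invertible_op (shifted_toep hk a b c lam).
Proof.
move=> [z [z1 detz]] [S [[_ [_ [M SM]]] [SA _]]].
have z0 : z != 0.
  by apply/eqP => z0; move: z1; rewrite z0 sqmod0 => /eqP; rewrite eq_sym oner_eq0.
pose F := poly_symbol a b c lam.
have [v [j0 [vj0 vE]]] : exists (v : 'I_k -> C) (j0 : 'I_k), v j0 != 0 /\
    forall i, \sum_j (symbol a b c z - lam%:M) i j * v j = 0.
  have /det0P[w w0 wE] : \det (symbol a b c z - lam%:M)^T == 0 by rewrite det_tr detz.
  have [j0 wj0] : exists j, w 0 j != 0.
    apply/existsP; apply: contraNT w0; rewrite negb_exists => /forallP w0.
    by apply/eqP/rowP => j; rewrite mxE; apply/eqP; rewrite -[_ == _]negbK w0.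
  exists (w 0), j0; split => // i; have /rowP/(_ i) := wE.
  rewrite !mxE => E; rewrite -[RHS]E; apply: eq_bigr => j _.
  by rewrite mulrC !mxE.
have /choice[h hE] : forall i, exists h, \sum_j F i j * (v j)%:P = h * ('X - z%:P).
  move=> i; apply/factor_theorem; rewrite /root horner_sum.
  rewrite (eq_bigr (fun j => z * ((symbol a b c z - lam%:M) i j * v j))).
    by rewrite -mulr_sumr vE mulr0.
  move=> j _; rewrite !mxE !hornerE /=; field.
  exact: z0.
have /choice[Mh MhP] : forall i, exists Mi : R, 0 <= Mi /\
    forall (y : int -> C) K, l2Z_le y K -> l2Z_le (act (h i) y) (Mi * K).
  by move=> i; have [Mi ? ?] := act_l2Z (h i); exists Mi.
pose zeta := z^-1; have zeta1 : sqmod zeta = 1 by rewrite sqmodV z1 invr1.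
pose L := (\sum_i Mh i) * 4.
have Lle i : Mh i * 4 <= L.
  rewrite ler_wpM2r // (bigD1 i) //= lerDl sumr_ge0 // => j _.
  by case: (MhP j).
have : sqmod (v j0) <= 0; last first.
  rewrite leNgt => /negP; apply; rewrite lt_neqAle sqmod_ge0 andbT eq_sym.
  by apply: contra_neq vj0; exact: sqmod_eq0.
apply: (@bounded_multiples _ (`|M| * (k%:R * L))) => N.
pose q : {poly C} := \sum_(l < N) (zeta%:P * 'X) ^+ l.
pose X j n := v j * act q (delta R 0) n.
pose x := unblock hk X.
have xX : block x = X.
  apply/funext => j; apply/funext => n; apply: unblockK => {}j {}n n0.
  by rewrite /X act_delta_small // mulr0.
have FX i : blockact F X i = act (h i) (act (('X - z%:P) * q) (delta R 0)).
  apply/funext => n; rewrite -!actM mulrA -hE mulr_suml act_sum.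
  by apply: eq_bigr => j _; rewrite !actM (eq_act _ (act_polyC _ _)).
have qE : ('X - z%:P) * q = z%:P * ((zeta ^+ N)%:P * 'X^N - 1).
  rewrite rmorphXn /= -exprMn subrX1 mulrA; congr (_ * _).
  by rewrite mulrBr mulr1 mulrA -polyCM divff // mul1r.
have FK i : l2Z_le (blockact F X i) L.
  apply: l2Z_le_weak (Lle i) _; rewrite FX qE; apply: (MhP i).2.
  have dN := l2Z_leZ (zeta ^+ N) (l2Z_le_shift (- N%:Z) (l2Z_le_delta R 0)).
  have := l2Z_leZ z (l2Z_leD dN (l2Z_leZ (-1) (l2Z_le_delta R 0))).
  rewrite z1 sqmodX zeta1 expr1n sqmodN sqmod1 !mul1r.
  rewrite (_ : 2 * (1 + 1) = 4 :> R); last by ring.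
  congr l2Z_le; apply/funext => n.
  by rewrite actCM actD actN actMXn act_polyC act1 mulN1r.
have TxE : shifted_toep hk a b c lam x = unblock hk (fun i n => blockact F X i (n + 1)).
  by rewrite shifted_toep_block xX.
have [Tx2 Txn] := unblock_l2 hk (fun i => l2Z_le_shift 1 (FK i)).
have [Mq Mq0 HMq] := act_l2Z q.
have x2 : l2 x.
  apply: (proj1 (unblock_l2 hk (K := (\sum_j sqmod (v j)) * (Mq * 1)) _)) => j.
  apply: l2Z_le_weak (l2Z_leZ (v j) (HMq _ _ (l2Z_le_delta R 0))).
  rewrite ler_wpM2r ?mulr1 // (bigD1 j) //= lerDl.
  by rewrite sumr_ge0 // => ? _; exact: sqmod_ge0.
have xle : l2norm2 x <= `|M| * (k%:R * L).
  rewrite -[x in l2norm2 x](SA x x2) TxE; apply: le_trans (SM _ Tx2) _.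
  apply: (@le_trans _ _ (`|M| * l2norm2 (unblock hk (fun i n => blockact F X i (n + 1))))).
    by rewrite ler_wpM2r ?l2norm2_ge0 // ler_norm.
  by rewrite ler_wpM2l.
apply: le_trans _ xle; have := block_l2Z j0 x2 0 N; apply: le_trans.
rewrite mulr_natl -[N in _ *+ N]card_ord -sumr_const; apply: ler_sum => l _.
rewrite xX /X sqmodM add0r act_delta0 (_ : q`_l = zeta ^+ l).
  by rewrite sqmodX zeta1 expr1n mulr1.
rewrite /q coef_sum (bigD1 l) //= big1 ?addr0 => [|j jl].
  by rewrite exprMn -rmorphXn coefCM coefXn eqxx mulr1.
rewrite exprMn -rmorphXn coefCM coefXn.
by rewrite (_ : (l == j :> nat) = false) ?mulr0 // eq_sym; apply: negbTE.
Qed.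

End Obstructions.

Section Spectrum.
Variables (R : realType) (m : nat) (hk : (0 < m.+1)%N).
Local Notation C := (R[i]).
Local Notation k := m.+1.
Implicit Types (a b c : 'I_k -> C) (lam kappa r s al be ga : C).

Lemma symbol_tr a b c z : (symbol a b c z)^T = symbol a c b z^-1.
Proof.
apply/matrixP => i j; rewrite !mxE invrK [j == i]eq_sym.
rewrite [(\val j == _) && _]andbC [(\val i == 0%N) && _]andbC.
have -> : forall u v w : C, u + v + w = w + v + u by move=> u v w; ring.
congr (_ + _ + _); first by rewrite andbC.
have [->//|_] := eqVneq i j.
by case: eqP => [e|_] //; case: eqP => // e'; exfalso; lia.
Qed.

Lemma laurent_inj al be ga al' be' ga' :
  (forall z, z != 0 -> al / z + be + ga * z = al' / z + be' + ga' * z) ->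
  [/\ al = al', be = be' & ga = ga'].
Proof.
move=> E.
pose D z := (al / z + be + ga * z) - (al' / z + be' + ga' * z).
have D0 z : z != 0 -> D z = 0 by move=> z0; rewrite /D E // subrr.
have D1 : D 1 = 0 by apply: D0; exact: oner_neq0.
have D2 : D 2 = 0 by apply: D0; rewrite pnatr_eq0.
have DN : D (-1) = 0 by apply: D0; rewrite oppr_eq0 oner_eq0.
have be0 : be - be' = 0.
  have -> : be - be' = (D 1 + D (-1)) / 2 by rewrite /D; field.
  by rewrite D1 DN addr0 mul0r.
have ga0 : ga - ga' = 0.
  have -> : ga - ga' = (2 * D 2 - D 1 - (be - be')) / 3 by rewrite /D; field.
  by rewrite D1 D2 be0 mulr0 !subr0 mul0r.
have al0 : al - al' = 0.
  have -> : al - al' = D 1 - (be - be') - (ga - ga') by rewrite /D; field.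
  by rewrite D1 be0 ga0 !subr0.
by split; apply/eqP; rewrite -subr_eq0; apply/eqP.
Qed.

Lemma quadratic_inj al be ga al' be' ga' :
  quadratic al be ga = quadratic al' be' ga' -> [/\ al = al', be = be' & ga = ga'].
Proof.
move=> E; have c i := congr1 (fun p : {poly C} => p`_i) E.
by split; [move: (c 0%N)|move: (c 1%N)|move: (c 2%N)];
  rewrite /quadratic !coefD !coefCM !coefC !coefXn !coefX /= !(mulr0, mulr1, addr0, add0r).
Qed.

Lemma mixed_quadraticE kappa r s : mixed_quadratic kappa r s =
  quadratic (- kappa * r) (kappa * (1 + r * s)) (- kappa * s).
Proof.
by rewrite /mixed_quadratic /quadratic !(rmorphD, rmorphM, rmorphN, rmorph1) /=; ring.
Qed.

Lemma outer_quadraticE kappa r s : outer_quadratic kappa r s =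
  quadratic kappa (- kappa * (r + s)) (kappa * (r * s)).
Proof.
by rewrite /outer_quadratic /quadratic !(rmorphD, rmorphM, rmorphN, rmorph1) /=; ring.
Qed.

Lemma inner_quadraticE kappa r s : inner_quadratic kappa r s =
  quadratic (kappa * (r * s)) (- kappa * (r + s)) kappa.
Proof.
by rewrite /inner_quadratic /quadratic !(rmorphD, rmorphM, rmorphN, rmorph1) /=; ring.
Qed.

Lemma det_poly_symbol_tr a b c lam al be ga :
  \det (poly_symbol a b c lam) = quadratic al be ga * 'X^m ->
  \det (poly_symbol a c b lam) = quadratic ga be al * 'X^m /\
  (ga != 0 -> forall i, c i != 0).
Proof.
move=> detE; have [al' [be' [ga' [detE' c0]]]] := det_poly_symbol a c b lam.
have [e1 e2 e3] : [/\ al' = ga, be' = be & ga' = al].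
  apply: laurent_inj => z z0; rewrite -(det_symbol_quadratic detE' z0).
  have zV : z^-1 != 0 by rewrite invr_eq0.
  rewrite -{1}(invrK z) -symbol_tr -[lam%:M]tr_scalar_mx -linearB /= det_tr.
  by rewrite (det_symbol_quadratic detE zV) invrK; ring.
by rewrite -e1 -e2 -e3.
Qed.

Lemma det_curve_quadratic a b c lam al be ga t :
  \det (poly_symbol a b c lam) = quadratic al be ga * 'X^m ->
  det_curve a b c lam t = al * expit (- t) + be + ga * expit t.
Proof.
by move=> /det_symbol_quadratic/(_ (expit_neq0 t)); rewrite expitN.
Qed.

Variables (a b c : 'I_k -> C) (lam : C).

Variant spectral_spec : Prop :=
| SpectralMixed of winding_number (det_curve a b c lam) 0
    & (\det (B0 a b c - lam%:M) != 0 -> invertible_op (shifted_toep hk a b c lam))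
| SpectralOuter (d : R) of winding_number (det_curve a b c lam) d & d != 0
    & ~ invertible_op (shifted_toep hk a b c lam).

Lemma spectralP : ~ sigma_det a b c lam -> spectral_spec.
Proof.
move=> ndet; have [al [be [ga [detE al0]]]] := det_poly_symbol a b c lam.
have nz z : sqmod z = 1 -> al + be * z + ga * z ^+ 2 != 0.
  move=> z1; have z0 : z != 0.
    by apply/eqP => z0; move: z1; rewrite z0 sqmod0 => /eqP; rewrite eq_sym oner_eq0.
  apply/eqP => E; apply: ndet; exists z; split => //.
  rewrite (det_symbol_quadratic detE z0); apply: (mulfI z0).
  by rewrite mulr0 -E; field.
have e1 : expit (1 * (2 * pi)) = 1 :> C by rewrite mul1r expit_2pi.
have eN1 : expit (-1 * (2 * pi)) = 1 :> C by rewrite mulN1r expitN expit_2pi invr1.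
have eV t : expit t * expit (- t) = 1 :> C by rewrite -expitD subrr expit0.
have [kappa r s k0 r1 s1 pE|kappa r s k0 r1 s1 pE|kappa r s k0 r1 s1 pE] := quadraticP nz.
- have [alE beE gaE] := quadratic_inj (etrans pE (mixed_quadraticE _ _ _)).
  apply: SpectralMixed.
    apply: (@winding_number_factored _ _ kappa r s (-1) 1 0) => // t.
    rewrite (det_curve_quadratic _ detE) alE beE gaE mul0r expit0 mulN1r mul1r.
    have -> : kappa * (1 + r * s) = kappa * (1 + r * s * (expit t * expit (- t))).
      by rewrite eV mulr1.
    by ring.
  by rewrite pE in detE; exact: (mixed_invertible hk k0 r1 s1 detE).
- have [alE beE gaE] := quadratic_inj (etrans pE (outer_quadraticE _ _ _)).
  apply: (@SpectralOuter (-1)); last 2 first.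
  - by rewrite oppr_eq0 oner_eq0.
  - have b0 : forall i, b i != 0 by apply: al0; rewrite alE.
    rewrite pE in detE; have [x [x2 x0 Tx]] := outer_kernel hk k0 r1 s1 b0 detE.
    exact: kernel_not_invertible x2 Tx x0.
  apply: (@winding_number_factored _ _ kappa r s 1 1 (-1)) => // t.
  rewrite (det_curve_quadratic _ detE) alE beE gaE mulN1r mul1r.
  have -> : kappa * expit (- t) * (1 - r * expit t) * (1 - s * expit t) =
    kappa * (expit (- t) - (r + s) * (expit t * expit (- t)) +
      r * s * expit t * (expit t * expit (- t))) by ring.
  by rewrite eV; ring.
- have [alE beE gaE] := quadratic_inj (etrans pE (inner_quadraticE _ _ _)).
  apply: (@SpectralOuter 1); last 2 first.
  - exact: oner_neq0.
  - have [detE' c0] := det_poly_symbol_tr detE.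
    rewrite gaE beE alE -outer_quadraticE in detE'.
    have {}c0 : forall i, c i != 0 by apply: c0; rewrite gaE.
    have [x [x2 x0 Tx]] := outer_kernel hk k0 r1 s1 c0 detE'.
    exact: transpose_kernel_not_invertible x2 x0 Tx.
  apply: (@winding_number_factored _ _ kappa r s (-1) (-1) 1) => // t.
  rewrite (det_curve_quadratic _ detE) alE beE gaE mulN1r mul1r.
  have -> : kappa * expit t * (1 - r * expit (- t)) * (1 - s * expit (- t)) =
    kappa * (expit t - (r + s) * (expit t * expit (- t)) +
      r * s * expit (- t) * (expit t * expit (- t))) by ring.
  by rewrite eV; ring.
Qed.

End Spectrum.

Theorem theorem2p6 (R : realType) (k : nat) (hk : (0 < k)%N)
    (a b c : 'I_k -> R[i]) :
  (forall lam : R[i],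
     sigma_det a b c lam \/ sigma_wind a b c lam ->
     op_spectrum (Toep hk a b c) lam) /\
  (forall lam : R[i],
     op_spectrum (Toep hk a b c) lam ->
     [\/ sigma_det a b c lam, sigma_wind a b c lam | eigenvalue (B0 a b c) lam]).
Proof.
case: k hk a b c => [//|m] hk a b c; split=> lam.
  case=> [sdet|[ndet [w [wn w0]]]]; first exact: sigma_det_not_invertible sdet.
  have [wn0|//] := spectralP hk ndet.
  by rewrite (winding_number_unique wn wn0) eqxx in w0.
move=> spec; have [|ndet] := pselect (sigma_det a b c lam); first by constructor 1.
have [_ inv|d wn d0 _] := spectralP hk ndet; last first.
  by constructor 2; split => //; exists d.
constructor 3; apply: det_B0_eigenvalue; apply/eqP; apply/negPn/negP => /inv.
exact: spec.
Qed.
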